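(* For a decreasing sequence $\{\ell_n\}_{n\ge1}$ of positive numbers tending to $0$ and either dynamical circle covering model (Brownian or Poisson) with lengths $\{\ell_n\}$ and associated random sets $E_t\subseteq C$, let $T:=\{t\in[0,1]:E_t\text{ is not dense in }C\}$. (a) In the Brownian model, for any such sequence $\{\ell_n\}_{n\ge1}$, $P(T\ne\varnothing)=0$. (b) In the Poisson model with parameter $\alpha>0$, if there is some $c$ such that $\ell_n\ge1/n^c$ for all $n$, then $P(T\ne\varnothing)=0$. In the Poisson model with $\alpha=0$, $P(T\neq\varnothing)=0$ for all such sequences $\{\ell_n\}_{n\ge1}$. (c) In the Poisson model with parameter $\alpha>0$, there exists such a sequence $\{\ell_n\}_{n\ge1}$ for which $P(T\ne\varnothing)=1$.
   Context: $C$ is the circle of circumference $1$, viewed as the quotient of $\mathbb{R}$ by $\mathbb{Z}$ via $u\mapsto \frac1{2\pi}(\cos 2\pi u,\sin2\pi u)$. Brownian model: $\{U_{n,t}\}_{t\ge0}$, $n\ge1$, are independent Brownian motions on $C$ (the projections to $C$ of Brownian motions on $\mathbb{R}$ with variance $1$ per unit time, with continuous paths), each started from the uniform distribution on $C$. Poisson model with parameter $\alpha\ge0$: let $\{C_{i,j}\}_{i,j\ge1}$ and $\{Y_{i,j}\}_{i,j\ge1}$ be mutually independent random variables, with $C_{i,j}$ uniformly distributed on $C$ and $Y_{i,j}$ exponentially distributed with rate parameter $\ell_i^{-\alpha}$; let $T_{i,0}:=0$ and $T_{i,j}:=\sum_{k=1}^jY_{i,k}$ for $j\ge1$, and let $U_{i,t}:=C_{i,j}$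 for $t\in[T_{i,j-1},T_{i,j})$. In either model, $I_{n,t}$ is the open arc of $C$ with center $U_{n,t}$ and length $\ell_n$ (an arc of length greater than $1$ is all of $C$), and $E_t:=\limsup_n I_{n,t}$ is the set of points belonging to $I_{n,t}$ for infinitely many $n$. *)

(* Defs.v *)
From HB Require Import structures.
From mathcomp Require Import all_boot all_order all_algebra finmap.
From mathcomp Require Import all_classical all_reals all_analysis.

Set Implicit Arguments.
Unset Strict Implicit.
Unset Printing Implicit Defensive.

Import Order.TTheory GRing.Theory Num.Theory.
Import numFieldNormedType.Exports.

Local Open Scope classical_set_scope.
Local Open Scope ring_scope.

(* Sequences indexed by n >= 1 in the mathematics are indexed by n : nat here:
   index n stands for n + 1. Time is a real t, of which only t >= 0 matters. *)

Section Circle.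
Context {R : realType}.

Definition circle_pt (u : R) : R * R :=
  ((2 * pi)^-1 * cos (2 * pi * u), (2 * pi)^-1 * sin (2 * pi * u)).

Definition circle : set (R * R) := range circle_pt.

(* Open arc of center p and length l; [circle_pt] has unit speed. For l > 1 it
   is the whole circle, and for l = 1 it only misses the antipode of p. *)
Definition arc (p : R * R) (l : R) : set (R * R) :=
  [set q | exists u v : R,
     [/\ circle_pt u = p, circle_pt v = q & `|v - u| < l / 2]].

Definition dense_in_circle (E : set (R * R)) : Prop := circle `<=` closure E.

(* Decreasing in the weak sense; ask for [decreasing_seq ell] in addition where
   a strictly decreasing sequence is wanted. *)
Definition lengths (ell : nat -> R) : Prop :=
  [/\ forall n, 0 < ell n, nonincreasing_seq ell & ell n @[n --> \oo] --> 0].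

End Circle.

Section Independence.
Context {d : measure_display} {W : measurableType d} {R : realType}.

Definition mutually_independent (I : choiceType) (P : probability W R)
    (F : I -> set (set W)) : Prop :=
  forall (J : {fset I}) (A : I -> set W),
    (forall i, i \in J -> F i (A i)) ->
    P (\bigcap_(i in [set` J]) A i) = (\prod_(i <- J) P (A i))%E.

Definition sigma_of d' (S : measurableType d') (X : W -> S) : set (set W) :=
  g_sigma_algebra_preimage X.

Definition sigma_of_process d' (S : measurableType d') (X : R -> W -> S) :
    set (set W) :=
  <<s \bigcup_(t in `[0, +oo[) sigma_of (X t) >>.

End Independence.

Section Models.
Context {d : measure_display} {W : measurableType d} {R : realType}.
Implicit Types (P : probability W R) (U : nat -> R -> W -> R * R).

Definition uniform_on_circle P (X : W -> R * R) : Prop :=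
  forall A : set (R * R), measurable A ->
    pushforward P X A = pushforward (uniform_prob (@ltr01 R)) circle_pt A.

(* [increment B s 0] is the initial value, which belongs to the family required
   to be independent: the initial law is arbitrary. *)
Definition increment (B : R -> W -> R) (s : nat -> R) (k : nat) : W -> R :=
  if k is k'.+1 then fun w => B (s k) w - B (s k') w else B (s 0%N).

(* The second parameter of [normal_prob] is the standard deviation. *)
Definition real_brownian_motion P (B : R -> {RV P >-> R}) : Prop :=
  [/\ forall w, {within `[0, +oo[, continuous (fun t => B t w)},
      forall s t, 0 <= s -> s < t -> forall A : set R, measurable A ->
        pushforward P (fun w => B t w - B s w) A =
        normal_prob 0 (Num.sqrt (t - s)) A
    & forall s : nat -> R, s 0%N = 0 -> nondecreasing_seq s ->
        mutually_independent P (fun k => sigma_of (increment B s k))].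

Definition circle_brownian_motion P (V : R -> W -> R * R) : Prop :=
  exists B : R -> {RV P >-> R},
    [/\ real_brownian_motion B,
        forall t w, 0 <= t -> V t w = circle_pt (B t w)
      & uniform_on_circle P (V 0)].

Definition brownian_model P U : Prop :=
  (forall n, circle_brownian_motion P (U n)) /\
  mutually_independent P (fun n => sigma_of_process (U n)).

Definition update_time (Y : nat -> W -> R) (j : nat) (w : W) : R :=
  \sum_(k < j) Y k w.

(* The update times almost surely partition [0, +oo[; on the exceptional null
   set, a value of j is chosen if there is one, and an arbitrary fixed point of
   the circle is used if there is none. *)
Definition poisson_position (C : nat -> W -> R * R) (Y : nat -> W -> R)
    (t : R) (w : W) : R * R :=
  xget (circle_pt 0)
    [set C j w | j in [set j | update_time Y j w <= t < update_time Y j.+1 w]].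

Definition poisson_model P (ell : nat -> R) (alpha : R) U : Prop :=
  exists (C : nat -> nat -> {RV P >-> (R * R)%type})
         (Y : nat -> nat -> {RV P >-> R}),
    [/\ forall i j w, circle (C i j w),
        forall i j, uniform_on_circle P (C i j),
        forall i j (A : set R), measurable A ->
          distribution P (Y i j) A = exponential_prob (ell i `^ (- alpha)) A,
        mutually_independent P
          (fun k : (nat * nat) + (nat * nat) =>
             match k with
             | inl (i, j) => sigma_of (C i j)
             | inr (i, j) => sigma_of (Y i j)
             end)
      & forall i t w, 0 <= t -> U i t w = poisson_position (C i) (Y i) t w].

Definition covered (ell : nat -> R) U (t : R) (w : W) : set (R * R) :=
  lim_sup_set (fun n => arc (U n t w) (ell n)).

Definition exceptional_times (ell : nat -> R) U (w : W) : set R :=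
  [set t | t \in `[0, 1] /\ ~ dense_in_circle (covered ell U t w)].

End Models.

(* Main.v *)
(* Only the centers of the arcs matter for (a) and (b).  By Baire, E_t is dense
   as soon as every cap of the circle contains, at time t, the centers of
   infinitely many arcs.  So it is enough to show that, for a fixed cap and a
   fixed N, almost surely at every time t of [0, 1] some center of index at
   least N lies in the cap.

   Brownian model: over a time interval of a fixed small length each center has
   a probability at least p > 0 of staying in the cap, where p does not depend
   on the index; by independence almost surely some center does.

   Poisson model with rates at most polynomial: consider m centers.  The set of
   centers changes only at update times, of which there are polynomially many
   in m; given the update times, the m positions right after one of them are
   independent and uniform, so they all miss the cap with probability
   (1 - p)^m.  A union bound concludes.

   (c): the lengths are chosen so sparse that the rate of the k-th center is
   enormous compared with the time scale 1/M_k produced at stage k.  With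
   probability at least 1 - 2^-k, every window of length 1/M_k then contains a
   window of a shorter length 1/M_(k+1) during which the k-th center stays in a
   fixed half of the circle.  By Borel-Cantelli these windows can almost surely
   be nested from some stage on, and at a common point t the set E_t avoids a
   neighbourhood of the midpoint of the other half. *)

Require Import Defs.
From HB Require Import structures.
From mathcomp Require Import all_boot all_order all_algebra finmap.
From mathcomp Require Import all_classical all_reals all_analysis.
From mathcomp Require Import measurable_realfun.
From mathcomp Require Import ring lra zify.

Set Implicit Arguments.
Unset Strict Implicit.
Unset Printing Implicit Defensive.

Import Order.TTheory GRing.Theory Num.Theory.
Import numFieldNormedType.Exports.

Local Open Scope classical_set_scope.
Local Open Scope ring_scope.

(** * Numerical estimates and the choice of the parameters *)

Lemma polynomial_geometric_small {R : realType} (k : nat) (r e : R) :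
  0 <= r < 1 -> 0 < e ->
  exists n0, forall n, (n0 <= n)%N -> n.+1%:R ^+ k * r ^+ n <= e.
Proof.
move=> /andP[r0 r1] e0.
(* The lower bound 1/2 makes [ln s] usable even when [r = 0], and costs only a factor 2 in passing
   from [s ^+ n] to [s ^+ n.+1], which is then bounded through the Taylor term of order [k.+1] of
   the exponential. *)
pose s := Num.max r (1/2).
have s0 : 0 < s by rewrite lt_max; apply/orP; right; lra.
have s1 : s < 1 by rewrite gt_max r1; lra.
have sh : 1/2 <= s by rewrite le_max lexx orbT.
pose x := - ln s; have x0 : 0 < x by rewrite oppr_gt0 ln_lt0// s0.
pose K := 2 * (k.+1)`!%:R / (x ^+ k.+1 * e).
exists (Num.truncn K) => n Kn.
have nK : K <= n.+1%:R.
  by apply: (le_trans (ltW (truncnS_gt K))); rewrite ler_nat.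
have rs : r ^+ n <= 2 * expR (- (x * n.+1%:R)).
  apply: (@le_trans _ _ (s ^+ n)).
    by apply: lerXn2r; rewrite ?nnegrE ?(ltW s0)// /s le_max lexx.
  rewrite -mulNr opprK expRM_natr lnK ?posrE// exprS mulrA ler_peMl//.
    by rewrite exprn_ge0// ltW.
  lra.
have xn0 : 0 < x * n.+1%:R by rewrite mulr_gt0.
have ex : expR (- (x * n.+1%:R)) <= k.+1`!%:R / (x * n.+1%:R) ^+ k.+1.
  rewrite expRN -[leRHS]invf_div lef_pV2 ?posrE ?expR_gt0 ?divr_gt0 ?exprn_gt0 ?ltr0n ?fact_gt0//.
  by apply: (le_trans _ (expR_ge1Dxn k (ltW xn0))); rewrite lerDr.
apply: (@le_trans _ _ (n.+1%:R ^+ k * (2 * (k.+1`!%:R / (x * n.+1%:R) ^+ k.+1)))).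
  by rewrite ler_wpM2l ?exprn_ge0//; apply: (le_trans rs); rewrite ler_pM2l.
have -> : n.+1%:R ^+ k * (2 * (k.+1`!%:R / (x * n.+1%:R) ^+ k.+1)) =
    (K / n.+1%:R) * e.
  rewrite /K exprMn (exprS n.+1%:R); field.
  by rewrite !expf_neq0 ?gt_eqF.
by rewrite ler_piMl ?(ltW e0)// ler_pdivrMr// mul1r.
Qed.

(** The left-hand side is the bound of [avoiding_le] with blocks of length [q = m]: [g] is the
    chance of a short waiting time, [h] that of missing the cap. As [L] is polynomial in [m], both
    geometric factors win. *)
Lemma poisson_horizon {R : realType} (k N : nat) (g h e : R) :
  0 <= g < 1 -> 0 <= h < 1 -> 0 < e ->
  exists m, exists2 L : nat, (0 < m)%N /\ L = ((N + m) ^ k).+1 &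
    m%:R * (L%:R * g ^+ m) + (m * (L * m))%:R * h ^+ m <= e.
Proof.
move=> g1 h1 e0.
(* From [N + m <= N.+1 * m.+1] one gets [L <= a * m.+1 ^ k]; the factor 2 absorbs the successor in
   [L]. *)
pose a : R := 2 * N.+1%:R ^+ k.
have a0 : 0 < a by rewrite mulr_gt0// exprn_gt0.
have e2 : 0 < e / (2 * a) by rewrite divr_gt0// mulr_gt0.
have [n1 n1P] := polynomial_geometric_small k.+2 g1 e2.
have [n2 n2P] := polynomial_geometric_small k.+2 h1 e2.
have [m [m0 {}n1P {}n2P]] : exists m, [/\ (0 < m)%N,
    m.+1%:R ^+ k.+2 * g ^+ m <= e / (2 * a) &
    m.+1%:R ^+ k.+2 * h ^+ m <= e / (2 * a)].
  exists (maxn n1 n2).+1; split=> //.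
  - by apply: n1P; rewrite leqW// leq_maxl.
  - by apply: n2P; rewrite leqW// leq_maxr.
exists m, ((N + m) ^ k).+1 => //.
have : ((N + m) ^ k).+1%:R <= a * m.+1%:R ^+ k.
  have Nm : ((N + m) ^ k <= (N.+1 * m.+1) ^ k)%N.
    by have [->//|k0] := posnP k; rewrite leq_exp2r//; lia.
  rewrite /a -mulrA -exprMn -natrM -natrX -natrM ler_nat.
  have := expn_gt0 (N.+1 * m.+1) k; rewrite muln_gt0 /=.
  by move: ((N + m) ^ k)%N ((N.+1 * m.+1) ^ k)%N Nm => x y; lia.
move: ((N + m) ^ k).+1 => L La.
have mm : m%:R <= m.+1%:R :> R by rewrite ler_nat.
have term (f : R) : 0 <= f < 1 -> m.+1%:R ^+ k.+2 * f ^+ m <= e / (2 * a) ->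
    (m * (L * m))%:R * f ^+ m <= e / 2.
  move=> /andP[f0 _] fe.
  apply: (@le_trans _ _ (a * (m.+1%:R ^+ k.+2 * f ^+ m))).
    rewrite mulrA ler_wpM2r ?exprn_ge0//.
    have -> : a * m.+1%:R ^+ k.+2 = m.+1%:R * ((a * m.+1%:R ^+ k) * m.+1%:R).
      by rewrite !exprS; ring.
    by rewrite !natrM ler_pM// ?mulr_ge0// ler_pM.
  apply: (le_trans (ler_wpM2l (ltW a0) fe)).
  have -> // : a * (e / (2 * a)) = e / 2 by field; rewrite gt_eqF.
have t1 := term _ g1 n1P; have t2 := term _ h1 n2P.
rewrite [leRHS]splitr lerD//; apply: le_trans t1.
rewrite mulrA; have [g0 _] := andP g1.
by rewrite ler_wpM2r ?exprn_ge0// -natrM ler_nat leq_mul2l leq_pmulr// orbT.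
Qed.

(** The summands are those of [stage_failure_le] for the rate [q ^ 2] and [L = (q ^ 2).+1]. The rate
    times the waiting bound 1/(4 M q) is q/(4 M), so the first three summands decay geometrically in
    [q]; [M'] is then taken large for the last one. *)
Lemma stage_parameters {R : realType} (M q0 : nat) (e : R) : (0 < M)%N -> 0 < e ->
  exists q M' : nat, [/\ (q0 < q)%N, (0 < M')%N &
    (q ^ 2).+1%:R * (1/2) ^+ q + ((q ^ 2).+1%:R * (1 - expR (-1)) ^+ q +
     (((q ^ 2).+1 * q)%:R * expR (- ((q ^ 2)%:R * (4 * M%:R * q%:R)^-1)) +
      ((q ^ 2).+1 * q)%:R * ((q ^ 2)%:R * (3 / M'%:R)))) <= e].
Proof.
move=> M0 e0; have MR : 0 < M%:R :> R by rewrite ltr0n.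
have e4 : 0 < e / 4 by rewrite divr_gt0.
have h1 : 0 <= (1/2 : R) < 1 by apply/andP; split; lra.
have g1 : 0 <= 1 - expR (-1 : R) < 1.
  have := expR_gt0 (-1 : R); have : expR (-1 : R) <= 1 by rewrite expR_le1; lra.
  by move=> ? ?; apply/andP; split; lra.
have f1 : 0 <= expR (- (4 * M%:R)^-1 : R) < 1.
  by rewrite expR_ge0 expR_lt1 oppr_lt0 invr_gt0 mulr_gt0.
have [n1 n1P] := polynomial_geometric_small 3 h1 e4.
have [n2 n2P] := polynomial_geometric_small 3 g1 e4.
have [n3 n3P] := polynomial_geometric_small 3 f1 e4.
have [q [q00 qq0 {}n1P {}n2P {}n3P]] : exists q, [/\ (0 < q)%N, (q0 < q)%N,
    q.+1%:R ^+ 3 * (1/2) ^+ q <= e / 4,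
    q.+1%:R ^+ 3 * (1 - expR (-1)) ^+ q <= e / 4 &
    q.+1%:R ^+ 3 * expR (- (4 * M%:R)^-1) ^+ q <= e / 4].
  exists (q0 + n1 + n2 + n3).+1; split=> //; [|apply: n1P|apply: n2P|apply: n3P].
  - by rewrite ltnS -!addnA leq_addr.
  - by rewrite leqW// -!addnA addnCA leq_addr.
  - by rewrite leqW// -addnA addnCA leq_addr.
  - by rewrite leqW// leq_addl.
have qR : 0 <= q%:R :> R by [].
have q2R : 0 <= q%:R ^+ 2 :> R by rewrite exprn_ge0.
have q3R : 0 <= q%:R ^+ 3 :> R by rewrite exprn_ge0.
have cube : q.+1%:R ^+ 3 = q%:R ^+ 3 + 3 * q%:R ^+ 2 + 3 * q%:R + 1 :> R.
  by rewrite -natr1; ring.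
have L1 : (q ^ 2).+1%:R <= q.+1%:R ^+ 3 :> R.
  by rewrite cube -natr1 natrX; lra.
have L2 : ((q ^ 2).+1 * q)%:R <= q.+1%:R ^+ 3 :> R.
  rewrite cube natrM -natr1 natrX.
  have -> : (q%:R ^+ 2 + 1) * q%:R = q%:R ^+ 3 + q%:R :> R by ring.
  lra.
pose K : R := ((q ^ 2).+1 * q)%:R * ((q ^ 2)%:R * 3).
pose M' := (Num.truncn (K / (e / 4))).+1.
have M'R : 0 < M'%:R :> R by rewrite ltr0n.
exists q, M'; split=> //.
have -> : (q ^ 2)%:R * (4 * M%:R * q%:R)^-1 = (4 * M%:R)^-1 * q%:R :> R.
  by rewrite natrX; field; rewrite !gt_eqF// ltr0n.
have -> : e = e / 4 + (e / 4 + (e / 4 + e / 4)) by field.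
apply: lerD; first by apply: (le_trans _ n1P); rewrite ler_wpM2r// exprn_ge0//; lra.
apply: lerD.
  by apply: (le_trans _ n2P); rewrite ler_wpM2r// exprn_ge0//; case/andP: g1.
apply: lerD.
  by rewrite -mulNr expRM_natr; apply: (le_trans _ n3P); rewrite ler_wpM2r// exprn_ge0 ?expR_ge0.
have -> : ((q ^ 2).+1 * q)%:R * ((q ^ 2)%:R * (3 / M'%:R)) = K / M'%:R.
  by rewrite /K !mulrA.
rewrite ler_pdivrMr// mulrC -ler_pdivrMr//.
by apply: ltW; exact: truncnS_gt.
Qed.

(** At stage [k], [(s k).2] is the grid inherited, [(s k.+1).1 ^ 2] the rate of the [k]-th center
    and [(s k.+1).2] the finer grid produced. The bounds 2^-k are summable, as Borel-Cantelli
    requires. *)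
Lemma stage_sequence (R : realType) : exists s : nat -> nat * nat, forall k,
  [/\ ((s k).1 < (s k.+1).1)%N, (0 < (s k).2)%N &
   let q := (s k.+1).1 in
    (q ^ 2).+1%:R * (1/2) ^+ q + ((q ^ 2).+1%:R * (1 - expR (-1)) ^+ q +
     (((q ^ 2).+1 * q)%:R * expR (- ((q ^ 2)%:R * (4 * (s k).2%:R * q%:R)^-1)) +
      ((q ^ 2).+1 * q)%:R * ((q ^ 2)%:R * (3 / (s k.+1).2%:R))))
    <= (1/2) ^+ k :> R].
Proof.
pose good (z : nat * (nat * nat)) (z' : nat * nat) :=
  let: (k, (q0, M)) := z in let: (q, M') := z' in
  [/\ (q0 < q)%N, (0 < M')%N &
    (q ^ 2).+1%:R * (1/2) ^+ q + ((q ^ 2).+1%:R * (1 - expR (-1)) ^+ q +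
     (((q ^ 2).+1 * q)%:R * expR (- ((q ^ 2)%:R * (4 * M%:R * q%:R)^-1)) +
      ((q ^ 2).+1 * q)%:R * ((q ^ 2)%:R * (3 / M'%:R)))) <= (1/2) ^+ k :> R].
have /choice[g gP] : forall z, exists z', (0 < z.2.2)%N -> good z z'.
  (* The pair [(0, 0)] is a placeholder for [M = 0], a case that [s0] excludes along the
     recursion. *)
  move=> [k [q0 M]]; have [M0|/negP nM] := boolP (0 < M)%N; last by exists (0, 0)%N.
  have ek : 0 < (1/2) ^+ k :> R by rewrite exprn_gt0//; lra.
  by have [q [M' qM']] := stage_parameters q0 M0 ek; exists (q, M').
pose s := fix s k : nat * nat := if k is k'.+1 then g (k', s k') else (1, 1)%N.
have s0 k : (0 < (s k).2)%N.
  elim: k => [//|k ih] /=; have := gP (k, s k) ih; rewrite /good.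
  by case: (s k) => q M; case: (g _) => q' M' [].
exists s => k; have := gP (k, s k) (s0 k); have := s0 k; rewrite /good /=.
by case: (s k) => q M M0; case: (g _) => q' M' [].
Qed.

Lemma nested_intervals {R : realType} (a b : nat -> R) :
  (forall n, a n <= a n.+1) -> (forall n, b n.+1 <= b n) ->
  (forall n, a n <= b n) -> exists t, forall n, a n <= t <= b n.
Proof.
move=> /nondecreasing_seqP a_nd /nonincreasing_seqP b_ni ab.
have aub m : ubound (range a) (b m).
  move=> _ [n _ <-]; have [nm|/ltnW mn] := leqP n m.
    exact: (le_trans (a_nd _ _ nm)).
  exact: (le_trans _ (b_ni _ _ mn)).
exists (sup (range a)) => n; apply/andP; split.
  by apply: ub_le_sup; [exists (b 0%N); exact: aub|exists n].
by apply: ge_sup; [exists (a 0%N), 0%N|exact: aub].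
Qed.

Lemma size_index_enum (I : finType) : size (index_enum I) = #|I|.
Proof. by rewrite cardT enumT [index_enum _]unlock. Qed.

(** * Null sets and union bounds *)

Section Probability.
Context {d : measure_display} {W : measurableType d} {R : realType}.
Variable P : probability W R.

(** Meant for sets defined by the existence of a time, which are uncountable unions: only measurable
    supersets of them are estimated. *)
Lemma negligible_small (A : set W) :
  (forall e : R, 0 < e ->
    exists B, [/\ measurable B, A `<=` B & (P B <= e%:E)%E]) ->
  P.-negligible A.
Proof.
move=> small.
have /choice[B Bp] : forall n : nat, exists B,
    [/\ measurable B, A `<=` B & (P B <= (n.+1%:R^-1 : R)%:E)%E].
  by move=> n; apply: small; rewrite invr_gt0.
exists (\bigcap_n B n); split.
- by apply: bigcapT_measurable => n; case: (Bp n).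
- apply/eqP; rewrite eq_le measure_ge0 andbT.
  apply/lee_addgt0Pr => e e0; rewrite add0e.
  have [n ne] : exists n : nat, n.+1%:R^-1 <= e.
    exists (Num.truncn e^-1); rewrite invf_ple ?posrE//.
    by apply/ltW; rewrite truncnS_gt.
  have [mB _ PB] := Bp n.
  apply: (le_trans _ (le_trans PB _)); last by rewrite lee_fin.
  apply: le_measure; rewrite ?inE//.
    by apply: bigcapT_measurable => k; case: (Bp k).
  exact: bigcap_inf.
- by move=> w Aw n _; have [_ AB _] := Bp n; exact: AB.
Qed.


Lemma negligible_countable (I : countType) (A : I -> set W) :
  (forall i, P.-negligible (A i)) -> P.-negligible (\bigcup_i A i).
Proof.
move=> An.
have : P.-negligible (\bigcup_n oapp A set0 (choice.unpickle n)).
  apply: negligible_bigcup => n; case: (choice.unpickle n) => [i|] //=.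
  exact: negligible_set0.
apply: negligibleS => w [i _ Aw]; exists (choice.pickle i) => //.
by rewrite choice.pickleK.
Qed.

Lemma bigcup_fintype (I : finType) (A : I -> set W) :
  \bigcup_i A i = \big[setU/set0]_(i : I) A i.
Proof.
rewrite -bigcup_seq; apply: eq_bigcupl; split=> i //= _.
exact: mem_index_enum.
Qed.

Lemma measurable_bigcup_fintype (I : finType) (A : I -> set W) :
  (forall i, measurable (A i)) -> measurable (\bigcup_i A i).
Proof. by move=> mA; rewrite bigcup_fintype; exact: bigsetU_measurable. Qed.

Lemma measurable_bigcap_fintype (I : finType) (A : I -> set W) :
  (forall i, measurable (A i)) -> measurable (\bigcap_i A i).
Proof.
move=> mA; rewrite -[X in measurable X]setCK; apply: measurableC.
rewrite setC_bigcap; apply: measurable_bigcup_fintype => i.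
exact: measurableC.
Qed.

Lemma probability_bigcup_le (I : finType) (A : I -> set W) (c : R) :
  (forall i, measurable (A i)) -> (forall i, (P (A i) <= c%:E)%E) ->
  (P (\bigcup_i A i) <= (#|I|%:R * c)%:E)%E.
Proof.
move=> mA PA; rewrite bigcup_fintype.
suff : forall s : seq I,
    (P (\big[setU/set0]_(i <- s) A i) <= ((size s)%:R * c)%:E)%E.
  by move=> /(_ (index_enum I)); rewrite size_index_enum.
elim=> [|i s ih]; first by rewrite big_nil measure0 mul0r.
rewrite big_cons; apply: (@le_trans _ _ (P (A i) + P (\big[setU/set0]_(i <- s) A i))%E).
  apply: measureU2 => //; exact: bigsetU_measurable.
by rewrite /= -natr1 mulrDl mul1r addrC EFinD leeD.
Qed.

Lemma probability_setU_le (A B : set W) (a b : R) :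
  measurable A -> measurable B -> (P A <= a%:E)%E -> (P B <= b%:E)%E ->
  (P (A `|` B) <= (a + b)%:E)%E.
Proof.
move=> mA mB PA PB; rewrite EFinD.
by apply: (le_trans (measureU2 _ mA mB)); exact: leeD.
Qed.

Lemma probability_setC_le (A : set W) (a : R) :
  measurable A -> (a%:E <= P A)%E -> (P (~` A) <= (1 - a)%:E)%E.
Proof. by move=> mA PA; rewrite probability_setC// EFinB leeB. Qed.

End Probability.

(** * Independence of finite families and of generated sigma-algebras *)

Section Independence.
Context {d : measure_display} {W : measurableType d} {R : realType}.
Variable P : probability W R.

Lemma independent_bigcap (I : choiceType) (F : I -> set (set W)) (K : finType)
    (f : K -> I) (A : K -> set W) :
  mutually_independent P F -> injective f -> (forall k, F (f k) (A k)) ->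
  P (\bigcap_k A k) = (\prod_(k : K) P (A k))%E.
Proof.
move=> indF inj_f FA.
(* [g] is the partial inverse of [f]; indices outside the image of [f] receive the event [setT]. *)
pose g i : option K := [pick k | f k == i].
have gf k : g (f k) = Some k.
  rewrite /g; case: pickP => [k' /eqP/inj_f -> //|/(_ k)].
  by rewrite eqxx.
pose J := [fset f k | k in K]%fset.
pose A' i := oapp A setT (g i).
have FA' i : i \in J -> F i (A' i).
  by move=> /imfsetP[k _ ->]; rewrite /A' gf.
have <- : \bigcap_(i in [set` J]) A' i = \bigcap_k A k.
  apply/seteqP; split=> w wA.
    move=> k _; have := wA (f k); rewrite /A' gf; apply => /=.
    by apply/imfsetP; exists k.
  by move=> i /imfsetP[k _ ->]; rewrite /A' gf; exact: wA.
rewrite (indF J A' FA') big_imfset /=; last by move=> x y _ _; exact: inj_f.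
by rewrite big_enum; apply: eq_bigr => k _; rewrite /A' gf.
Qed.

Lemma prode_le_exp (K : finType) (x : K -> \bar R) (r : R) :
  (forall k, 0 <= x k <= r%:E)%E -> (\prod_(k : K) x k <= (r ^+ #|K|)%:E)%E.
Proof.
move=> xr.
suff : forall s : seq K,
    (0 <= \prod_(k <- s) x k <= (r ^+ (size s))%:E)%E.
  by move=> /(_ (index_enum K)); rewrite size_index_enum => /andP[].
elim=> [|i s /andP[ih0 ih]]; first by rewrite big_nil /= expr0 lee_fin ler01 lexx.
have /andP[x0 xr'] := xr i.
by rewrite big_cons /= mule_ge0//= exprS EFinM lee_pmul.
Qed.

Lemma independent_bigcap_le (I : choiceType) (F : I -> set (set W)) (K : finType)
    (f : K -> I) (A : K -> set W) (r : R) :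
  mutually_independent P F -> injective f -> (forall k, F (f k) (A k)) ->
  (forall k, (P (A k) <= r%:E)%E) ->
  (P (\bigcap_k A k) <= (r ^+ #|K|)%:E)%E.
Proof.
move=> indF inj_f FA PA; rewrite (independent_bigcap indF inj_f FA).
by apply: prode_le_exp => k; rewrite measure_ge0 PA.
Qed.

End Independence.

Section IndependentSigma.
Context {d : measure_display} {W : measurableType d} {R : realType}.
Variables (P : probability W R) (I : choiceType) (F : I -> set (set W)).
Hypothesis indF : mutually_independent P F.
Hypothesis mF : forall i, F i `<=` measurable.
Hypothesis FT : forall i, F i setT.
Hypothesis FI : forall i, setI_closed (F i).

(** With [BJ] the intersection of the [B i], the finite measures sending [A] to the probability of
    its trace on [BJ] and to [P BJ * P A] agree on finite intersections of events with index in [K].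
    These form a pi-system, so the measures agree on the sigma-algebra it generates. *)
Lemma independent_generated (K : set I) (J : {fset I}) (B : I -> set W)
    (A : set W) :
  (forall i, i \in J -> ~ K i) -> (forall i, i \in J -> F i (B i)) ->
  <<s \bigcup_(i in K) F i >> A ->
  P (A `&` \bigcap_(i in [set` J]) B i) = (P A * \prod_(i <- J) P (B i))%E.
Proof.
move=> JK FB sA; rewrite -(indF FB).
set BJ := \bigcap_(i in _) _.
have mBJ : measurable BJ.
  rewrite /BJ bigcap_fset big_seq; apply: bigsetI_measurable => i iJ.
  exact/mF/FB.
(* [Y] is total, with value [setT] off [L], so that two members of [G] intersect index by index over
   the union of their supports. *)
pose G := [set X : set W | exists (L : {fset I}) (Y : I -> set W),
  [/\ [set` L] `<=` K, forall i, F i (Y i), forall i, i \notin L -> Y i = setT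
    & X = \bigcap_(i in [set` L]) Y i]].
have GM : G `<=` measurable.
  move=> _ [L [Y [_ FY _ ->]]]; rewrite bigcap_fset.
  by apply: bigsetI_measurable => i _; exact: mF.
have GT : G setT.
  exists fset0, (fun=> setT); split => //.
  by rewrite bigcap_fset big_nil.
have GI : setI_closed G.
  move=> _ _ [L [Y [LK FY LY ->]]] [L' [Y' [LK' FY' LY' ->]]].
  exists (L `|` L')%fset, (fun i => Y i `&` Y' i); split.
  - by move=> i /=; rewrite inE => /orP[/LK|/LK'].
  - by move=> i; exact: FI.
  - by move=> i; rewrite inE negb_or => /andP[/LY -> /LY' ->]; rewrite setIT.
  - apply/seteqP; split=> w.
      move=> [wY wY'] i /=; rewrite inE => /orP[] iL; split.
      + exact: wY.
      + by have [/wY'//|/LY' ->] := boolP (i \in L').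
      + by have [/wY//|/LY ->] := boolP (i \in L).
      + exact: wY'.
    by move=> wYY; split=> i iL; have [] := wYY i; rewrite /= ?inE ?iL ?orbT.
have PBJ : (0 <= fine (P BJ))%R by exact: fine_ge0.
pose m1 := mrestr P mBJ; pose m2 := mscale (NngNum PBJ) P.
suff : m1 A = m2 A.
  by rewrite /m1 /m2 /mrestr /mscale /= fineK ?fin_num_measure// muleC.
apply: (g_sigma_algebra_measure_unique G GM (fun _ : nat => setT)) => //.
- by rewrite bigcup_const.
- move=> _ [L [Y [LK FY LY ->]]].
  change (P (\bigcap_(i in [set` L]) Y i `&` BJ) =
    ((fine (P BJ))%:E * P (\bigcap_(i in [set` L]) Y i))%E).
  rewrite fineK ?fin_num_measure//.
  (* As [L] lies in [K] and [J] outside it, the two families merge into one, to which [indF]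
     applies. *)
  pose Z i := if i \in J then B i else Y i.
  have FZ i : i \in (L `|` J)%fset -> F i (Z i).
    by rewrite inE /Z; case: ifP => // iJ _; exact: FB.
  have LJ i : i \in L -> (i \in J) = false.
    by move=> iL; apply/negP => /JK; apply; exact: LK.
  have -> : \bigcap_(i in [set` L]) Y i `&` BJ =
      \bigcap_(i in [set` (L `|` J)%fset]) Z i.
    apply/seteqP; split=> w.
      move=> [wY wB] i /=; rewrite inE /Z.
      by have [iJ _|iJ] := boolP (i \in J); [exact: wB|rewrite orbF; exact: wY].
    move=> wZ; split=> i /= iL.
      by have := wZ i; rewrite /= inE iL /Z LJ//; apply.
    by have := wZ i; rewrite /= inE iL orbT /Z iL; apply.
  have perm_LJ : perm_eq (L `|` J)%fset (L ++ J).
    apply: uniq_perm; rewrite ?fset_uniq//.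
      rewrite cat_uniq !fset_uniq /= andbT; apply/hasPn => i iJ.
      by apply/negP => /LJ; rewrite iJ.
    by move=> i; rewrite inE mem_cat.
  rewrite (indF FZ) (perm_big _ perm_LJ)/= big_cat/= muleC; congr (_ * _)%E; last first.
    rewrite (indF (fun i _ => FY i)) big_seq [RHS]big_seq.
    by apply: eq_bigr => i iL; rewrite /Z LJ.
  rewrite (indF FB) big_seq [RHS]big_seq; apply: eq_bigr => i iJ.
  by rewrite /Z iJ.
- move=> _; change (P (setT `&` BJ) < +oo)%E.
  by rewrite setTI ltey_eq fin_num_measure.
- apply: sA; split; first exact: smallest_sigma_algebra.
  move=> X [i Ki FX]; apply: sub_sigma_algebra.
  exists [fset i]%fset, (fun j => if j == i then X else setT); split.
  - by move=> j /=; rewrite inE => /eqP ->.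
  - by move=> j; case: eqP => [->|].
  - by move=> j; rewrite inE => /negbTE ->.
  - by rewrite bigcap_fset big_seq_fset1 eqxx.
Qed.

End IndependentSigma.

Section IndependentSigmaFamily.
Context {d : measure_display} {W : measurableType d} {R : realType}.
Variables (P : probability W R) (I : choiceType) (F : I -> set (set W)).
Hypothesis indF : mutually_independent P F.
Hypothesis mF : forall i, F i `<=` measurable.
Hypothesis FT : forall i, F i setT.
Hypothesis FI : forall i, setI_closed (F i).

(** In use, [K] consists of the indices of all waiting times and [f] picks finitely many positions:
    an event about update times is independent of these positions jointly. *)
Lemma independent_generated_bigcap (K : set I) (J : finType) (f : J -> I)
    (B : J -> set W) (A : set W) :
  injective f -> (forall j, ~ K (f j)) -> (forall j, F (f j) (B j)) ->
  <<s \bigcup_(i in K) F i >> A ->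
  P (A `&` \bigcap_j B j) = (P A * \prod_(j : J) P (B j))%E.
Proof.
move=> inj_f fK FB sA.
pose g i : option J := [pick j | f j == i].
have gf j : g (f j) = Some j.
  rewrite /g; case: pickP => [j' /eqP/inj_f -> //|/(_ j)].
  by rewrite eqxx.
pose L := [fset f j | j in J]%fset.
pose B' i := oapp B setT (g i).
have FB' i : i \in L -> F i (B' i).
  by move=> /imfsetP[j _ ->]; rewrite /B' gf.
have LK i : i \in L -> ~ K i by move=> /imfsetP[j _ ->]; exact: fK.
have -> : \bigcap_j B j = \bigcap_(i in [set` L]) B' i.
  apply/seteqP; split=> w wB.
    by move=> i /imfsetP[j _ ->]; rewrite /B' gf; exact: wB.
  move=> j _; have := wB (f j); rewrite /B' gf; apply => /=.
  by apply/imfsetP; exists j.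
rewrite (independent_generated indF mF FT FI LK FB' sA).
rewrite big_imfset /=; last by move=> x y _ _; exact: inj_f.
by rewrite big_enum; congr (_ * _)%E; apply: eq_bigr => j _; rewrite /B' gf.
Qed.

End IndependentSigmaFamily.

(** * Caps of the circle and the Baire category reduction *)

Section CircleCaps.
Context {R : realType}.
Implicit Types (u v c r kappa x : R).

Lemma cos2pi_int x (k : int) : cos (2 * pi * (x + k%:~R)) = cos (2 * pi * x).
Proof.
have nat_case (y : R) (n : nat) : cos (2 * pi * (y + n%:R)) = cos (2 * pi * y).
  rewrite -(periodicn (@cosD2pi R) n (2 * pi * y)); congr cos.
  by rewrite -[_ *+ n]mulr_natr -[_ *+ 2]mulr_natr; ring.
case: k => n; first exact: nat_case.
by rewrite -(nat_case (x + _) n.+1) NegzE mulrNz subrK.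
Qed.

Lemma sin2pi_int x (k : int) : sin (2 * pi * (x + k%:~R)) = sin (2 * pi * x).
Proof.
have nat_case (y : R) (n : nat) : sin (2 * pi * (y + n%:R)) = sin (2 * pi * y).
  rewrite -(periodicn (@sinD2pi R) n (2 * pi * y)); congr sin.
  by rewrite -[_ *+ n]mulr_natr -[_ *+ 2]mulr_natr; ring.
case: k => n; first exact: nat_case.
by rewrite -(nat_case (x + _) n.+1) NegzE mulrNz subrK.
Qed.

Lemma circle_pt_int u (k : int) : circle_pt (u + k%:~R) = circle_pt u.
Proof. by rewrite /circle_pt cos2pi_int sin2pi_int. Qed.

(** The addition formulas express the translate through the cosine and sine of [2 * pi * u] alone,
    so two representatives of a point can be moved together. *)
Lemma circle_pt_add u v h :
  circle_pt u = circle_pt v -> circle_pt (u + h) = circle_pt (v + h).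
Proof.
have pi2 : (2 * pi : R)^-1 != 0.
  by rewrite invr_eq0 mulf_neq0// gt_eqF// pi_gt0.
move=> [/(mulfI pi2) cuv /(mulfI pi2) suv].
by rewrite /circle_pt !(mulrDr (2 * pi)) !cosD !sinD cuv suv.
Qed.

Lemma continuous_cos2pi : continuous (fun u : R => cos (2 * pi * u)).
Proof.
move=> u; apply: (@continuous_comp R R R (fun v => 2 * pi * v) cos).
  exact: mulrl_continuous.
exact: continuous_cos.
Qed.

Lemma continuous_sin2pi : continuous (fun u : R => sin (2 * pi * u)).
Proof.
move=> u; apply: (@continuous_comp R R R (fun v => 2 * pi * v) sin).
  exact: mulrl_continuous.
exact: continuous_sin.
Qed.

Lemma continuous_circle_pt : continuous (@circle_pt R).
Proof.
move=> u; apply: (@cvg_pair R R R (nbhs u) (nbhs (circle_pt u).1)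
    (nbhs (circle_pt u).2) _ _ _
    (fun v => (2 * pi)^-1 * cos (2 * pi * v))
    (fun v => (2 * pi)^-1 * sin (2 * pi * v))).
- by apply: cvgM; [exact: cvg_cst|exact: continuous_cos2pi].
- by apply: cvgM; [exact: cvg_cst|exact: continuous_sin2pi].
Qed.

Lemma measurable_circle_pt : measurable_fun setT (@circle_pt R).
Proof.
apply: measurable_fun_pair; apply: measurable_funM => //;
  apply: continuous_measurable_fun.
- exact: continuous_cos2pi.
- exact: continuous_sin2pi.
Qed.

(* On the circle, the open arc of the points at angle less than
   [acos kappa] from [circle_pt c]; as a half-plane it is visibly measurable. *)
Definition cap c kappa : set (R * R) :=
  [set q | kappa < 2 * pi * (q.1 * cos (2 * pi * c) + q.2 * sin (2 * pi * c))].

Lemma cap_circle_pt c kappa u :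
  cap c kappa (circle_pt u) <-> kappa < cos (2 * pi * (u - c)).
Proof.
rewrite /cap /circle_pt /= mulrBr cosB.
have -> // : 2 * pi *
  ((2 * pi)^-1 * cos (2 * pi * u) * cos (2 * pi * c) +
   (2 * pi)^-1 * sin (2 * pi * u) * sin (2 * pi * c)) =
   cos (2 * pi * u) * cos (2 * pi * c) + sin (2 * pi * u) * sin (2 * pi * c).
have pi0 : pi != 0 :> R by rewrite gt_eqF// pi_gt0.
by move: (pi : R) pi0 => p p0; field; exact: p0.
Qed.

Lemma measurable_cap c kappa : measurable (cap c kappa).
Proof.
rewrite -[cap _ _]setTI.
pose f (q : R * R) := 2 * pi * (q.1 * cos (2 * pi * c) + q.2 * sin (2 * pi * c)).
have mf : measurable_fun setT f.
  apply: measurable_funM => //; apply: measurable_funD.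
    by apply: measurable_funM => //; exact: measurable_fst.
  by apply: measurable_funM => //; exact: measurable_snd.
have -> : cap c kappa = f @^-1` `]kappa, +oo[%classic.
  by apply/seteqP; split=> q /=; rewrite in_itv/= andbT.
exact: mf.
Qed.

Lemma cos2pi_gt_near_int kappa : kappa < 1 ->
  exists2 s, 0 < s <= 1/2 &
    forall x (k : int), `|x - k%:~R| < s -> kappa < cos (2 * pi * x).
Proof.
move=> k1.
have c0 := @continuous_cos2pi 0.
rewrite /continuous_at mulr0 cos0 in c0.
have : \forall x \near (0 : R), kappa < cos (2 * pi * x).
  exact: (cvgr_gt _ c0).
move=> /nbhs_ballP[e /= e0 eP].
exists (Num.min e (1/2)); first by rewrite lt_min e0 ge_min lexx orbT; lra.
move=> x k; rewrite lt_min => /andP[xe _].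
have := eP (x - k%:~R); rewrite /ball/= sub0r normrN => /(_ xe).
by rewrite -(cos2pi_int _ k) subrK.
Qed.

Lemma cos2pi_decr x r : 0 <= r -> r <= x -> x <= 1/2 ->
  cos (2 * pi * x) <= cos (2 * pi * r).
Proof.
move=> r0 rx x1; rewrite -subr_ge0.
have pi0 := @pi_gt0 R.
pose a := pi * (x + r); pose b := pi * (x - r).
have -> : 2 * pi * x = a + b by rewrite /a /b; ring.
have -> : 2 * pi * r = a - b by rewrite /a /b; ring.
have -> : cos (a - b) - cos (a + b) = 2 * (sin a * sin b).
  by rewrite cosB cosD; ring.
have scaled (t : R) : 0 <= t <= 1 -> 0 <= sin (pi * t).
  move=> /andP[t0 t1]; apply: sin_ge0_pi; rewrite (mulr_ge0 (ltW pi0) t0)/=.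
  by rewrite -[leRHS]mulr1 ler_pM2l.
rewrite !mulr_ge0//; apply: scaled; lra.
Qed.

Lemma nearest_int x : exists k : int, `|x - k%:~R| <= 1/2.
Proof.
exists (Num.floor (x + 1/2)); rewrite ler_norml.
have := floor_le (x + 1/2); have := floorD1_gt (x + 1/2).
rewrite intrD => h1 h2; apply/andP; split; lra.
Qed.

(** Converse to [cos2pi_gt_near_int]: caps are arbitrarily short when [kappa] is close to 1. *)
Lemma near_int_cos2pi_gt r : 0 < r ->
  exists2 kappa, kappa < 1 &
    forall x, kappa < cos (2 * pi * x) -> exists k : int, `|x - k%:~R| < r.
Proof.
(* Truncating at 1/2 keeps to the range where the cosine decreases; the distance to a nearest
   integer lies in that range too. *)
move=> r0; pose r' := Num.min r (1/2).
have r'0 : 0 < r' by rewrite lt_min r0; lra.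
have r'1 : r' <= 1/2 by rewrite ge_min lexx orbT.
exists (cos (2 * pi * r')).
  pose b := pi * r'; have -> : 2 * pi * r' = b + b by rewrite /b; ring.
  rewrite cosD -!expr2 cos2sin2 -subr_gt0.
  have : 0 < sin b.
    apply: sin_gt0_pi; have pi0 := @pi_gt0 R.
    rewrite mulr_gt0//= -[ltRHS]mulr1 ltr_pM2l//; lra.
  by move=> sb; have := mulr_gt0 sb sb; rewrite -expr2 => ?; lra.
move=> x; have [k xk] := nearest_int x; move=> cx; exists k.
apply: (@lt_le_trans _ _ r'); last by rewrite ge_min lexx.
rewrite ltNge; apply/negP => rx.
have := cos2pi_decr (ltW r'0) rx xk.
rewrite leNgt => /negP; apply.
have -> : cos (2 * pi * `|x - k%:~R|) = cos (2 * pi * x).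
  have -> : 2 * pi * `|x - k%:~R| = `|2 * pi * (x - k%:~R)|.
    by rewrite normrM (ger0_norm (_ : 0 <= 2 * pi))// mulr_ge0 ?pi_ge0.
  by rewrite cos_norm -(cos2pi_int _ k) subrK.
exact: cx.
Qed.

Lemma arc_of_center u l : 0 < l -> Defs.arc (circle_pt u) l (circle_pt u).
Proof. by move=> l0; exists u, u; split => //; rewrite subrr normr0 divr_gt0. Qed.

Lemma open_arc_preimage (p : R * R) l : open (circle_pt @^-1` (Defs.arc p l)).
Proof.
rewrite openE => v [u [v' [up vv' uv]]].
apply/nbhs_ballP; exists (l / 2 - `|v' - u|); first by rewrite /= subr_gt0.
move=> y; rewrite /ball/= => vy.
exists u, (v' + (y - v)); split => //.
  by rewrite (circle_pt_add (y - v) vv') addrC subrK.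
have -> : v' + (y - v) - u = (v' - u) + (y - v) by ring.
by apply: (le_lt_trans (ler_normD _ _)); rewrite -ltrBrDl distrC.
Qed.

Lemma rat_between (x y : R) : x < y -> exists2 q : rat, x < ratr q & ratr q < y.
Proof. by move=> /rat_in_itvoo[q]; rewrite in_itv/= => /andP[]; exists q. Qed.

(** Baire is applied on the line: [O N] is the lift of the union of the arcs of index at least [N].
    It is open, and dense because every interval contains lifts of such centers. Rational caps leave
    countably many conditions to check. *)
Lemma dense_limsup_arcs (p : nat -> R * R) (ell : nat -> R) :
  (forall n, 0 < ell n) -> (forall n, circle (p n)) ->
  (forall N (c kappa : rat), ratr kappa < 1 :> R ->
    exists2 n, (N <= n)%N & cap (ratr c) (ratr kappa) (p n)) ->
  dense_in_circle (lim_sup_set (fun n => Defs.arc (p n) (ell n))).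
Proof.
move=> ell0 circ often.
pose O N := \bigcup_(n >= N) (circle_pt @^-1` Defs.arc (p n) (ell n)).
have odO N : open (O N : set R^o) /\ dense (O N : set R^o).
  split; first by apply: bigcup_open => n _; exact: open_arc_preimage.
  move=> D [v0 Dv0] oD.
  have /nbhs_ballP[r /= r0 rD] : nbhs v0 D by exact: open_nbhs_nbhs.
  have r20 : 0 < r / 2 by rewrite divr_gt0.
  have [k k1 kP] := near_int_cos2pi_gt r20.
  have [kappa kk kappa1] := rat_between k1.
  have v0r : v0 < v0 + r / 2 by rewrite ltrDl.
  have [c vc cv] := rat_between v0r.
  have [n Nn] := often N c kappa kappa1.
  have [u _ un] := circ n; rewrite -un cap_circle_pt => /(lt_trans kk) /kP[m um].
  (* The representative [u] of the center is shifted by an integer to lie within [r / 2] of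
     [ratr c], itself within [r / 2] of [v0]. *)
  exists (u - m%:~R); split.
    apply: rD; rewrite /ball/=.
    have -> : v0 - (u - m%:~R) = (v0 - ratr c) - (u - ratr c - m%:~R) by ring.
    rewrite (le_lt_trans (ler_normB _ _))// [ltRHS]splitr ltrD//.
    by rewrite distrC ger0_norm; lra.
  exists n => //=; rewrite -un -mulrNz circle_pt_int; exact: arc_of_center.
have dO := @Baire R R^o _ odO.
move=> _ [v0 _ <-]; rewrite closureEnbhs => A B + nB.
move=> /= GA.
have nv0 : nbhs v0 (circle_pt @^-1` B) by exact: continuous_circle_pt.
have [v [Bv Ov]] : (circle_pt @^-1` B)° `&` \bigcap_i O i !=set0.
  by apply: dO; [exists v0|exact: open_interior].
exists (circle_pt v); split; last exact: (interior_subset Bv).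
apply: GA => N _; have [n Nn An] := Ov N I.
by exists n.
Qed.

End CircleCaps.

Section ExceptionalReduction.
Context {d : measure_display} {W : measurableType d} {R : realType}.
Variables (P : probability W R) (ell : nat -> R) (U : nat -> R -> W -> R * R).

Lemma negligible_exceptional_times :
  (forall n, 0 < ell n) ->
  (forall n t w, 0 <= t -> circle (U n t w)) ->
  (forall N (c kappa : R), kappa < 1 ->
    P.-negligible [set w | exists2 t, t \in `[0, 1] &
      forall n, (N <= n)%N -> ~ cap c kappa (U n t w)]) ->
  P.-negligible [set w | exceptional_times ell U w !=set0].
Proof.
move=> ell0 Ucirc Pcap.
(* Rational parameters make the family countable; indices with [kappa >= 1], outside the scope of
   the hypothesis, receive the empty set. *)
pose A (i : nat * (rat * rat)) : set W := if ratr i.2.2 < 1 :> R then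
  [set w | exists2 t, t \in `[0, 1] &
      forall n, (i.1 <= n)%N -> ~ cap (ratr i.2.1) (ratr i.2.2) (U n t w)]
  else set0.
have : P.-negligible (\bigcup_i A i).
  apply: negligible_countable => i; rewrite /A; case: ifP => [k1|_].
    exact: Pcap.
  exact: negligible_set0.
apply: negligibleS => w [t [t01 ndense]].
apply: contrapT => nA; apply: ndense; apply: dense_limsup_arcs => //.
  by move=> n; apply: Ucirc; move: t01; rewrite in_itv/= => /andP[].
move=> N c k k1; apply: contrapT => none; apply: nA.
exists (N, (c, k)) => //; rewrite /A /= k1; exists t => // n Nn capn.
by apply: none; exists n.
Qed.

End ExceptionalReduction.

(** * Uniform and exponential laws *)

Section UniformExponential.
Context {d : measure_display} {W : measurableType d} {R : realType}.
Variable P : probability W R.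

Lemma uniform_prob_itv (a b : R) : 0 <= a -> a <= b -> b <= 1 ->
  uniform_prob (@ltr01 R) `[a, b]%classic = (b - a)%:E.
Proof.
move=> a0 ab b1; rewrite /uniform_prob.
rewrite (eq_integral (fun=> 1%E)); last first.
  move=> x; rewrite inE/= in_itv/= => /andP[ax xb].
  by rewrite /uniform_pdf (le_trans a0 ax) (le_trans xb b1)/= subr0 invr1.
rewrite integral_cst//= mul1e lebesgue_measure_itv/= lte_fin.
rewrite le_eqVlt in ab; case/orP: ab => [/eqP ->|->]; last by rewrite EFinB.
by rewrite ltxx subrr.
Qed.

Lemma uniform_on_circle_ge (X : W -> R * R) (A : set (R * R)) (a b : R) :
  uniform_on_circle P X -> measurable A -> 0 <= a -> a <= b -> b <= 1 ->
  (forall u, a <= u <= b -> A (circle_pt u)) ->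
  ((b - a)%:E <= P (X @^-1` A))%E.
Proof.
move=> uX mA a0 ab b1 itvA.
have := uX A mA; rewrite /pushforward => ->.
rewrite -uniform_prob_itv//; apply: le_measure; rewrite ?inE//.
by rewrite -[X in measurable X]setTI; apply: measurable_circle_pt.
Qed.

(** The constant [p] depends on [kappa] alone. After reducing the center to [c'] in [0, 1], an
    interval of length [s / 2] beside it, to the right if [c' <= 1/2] and to the left otherwise,
    stays in [0, 1] because [s <= 1/2], so nothing wraps around. *)
Lemma uniform_on_circle_cap (kappa : R) : kappa < 1 ->
  exists2 p : R, 0 < p & forall (X : W -> R * R) (c : R),
    uniform_on_circle P X -> (p%:E <= P (X @^-1` cap c kappa))%E.
Proof.
move=> k1; have [s /andP[s0 s1] sP] := cos2pi_gt_near_int k1.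
exists (s / 2); first by rewrite divr_gt0.
move=> X c uX.
have [fl fu] := (floor_le c, floorD1_gt c).
rewrite intrD in fu.
pose k := Num.floor c; pose c' := c - k%:~R.
have capE u : `|u - c'| < s -> cap c kappa (circle_pt u).
  move=> uc; apply/cap_circle_pt; apply: (sP _ (- k)).
  by rewrite mulrNz opprK -addrA (addrC (- c)) -[_ + - c]opprB.
have [c'0 c'1] : 0 <= c' /\ c' <= 1 by rewrite /c' /k; split; lra.
have [c2|c2] := lerP c' (1/2).
  have -> : s / 2 = (c' + s / 2) - c' by ring.
  apply: (uniform_on_circle_ge uX (measurable_cap c kappa)); [lra|lra|lra|].
  by move=> u /andP[cu uc]; apply: capE; rewrite ger0_norm; lra.
have -> : s / 2 = c' - (c' - s / 2) by ring.
apply: (uniform_on_circle_ge uX (measurable_cap c kappa)); [lra|lra|lra|].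
by move=> u /andP[cu uc]; apply: capE; rewrite ler0_norm; lra.
Qed.

Section exponential.
Variables (Y : {RV P >-> R}) (rate : R).
Hypothesis lawY : forall A : set R, measurable A ->
  distribution P Y A = exponential_prob rate A.

Lemma exponential_measurable_lt (x : R) : measurable [set w | Y w < x].
Proof.
have -> : [set w | Y w < x] = Y @^-1` `]-oo, x[%classic.
  by apply/seteqP; split=> w; rewrite /= in_itv.
by rewrite -[X in measurable X]setTI; exact: measurable_funP.
Qed.

Lemma exponential_measurable_gt (x : R) : measurable [set w | x < Y w].
Proof.
have -> : [set w | x < Y w] = Y @^-1` `]x, +oo[%classic.
  by apply/seteqP; split=> w; rewrite /= in_itv/= andbT.
by rewrite -[X in measurable X]setTI; exact: measurable_funP.
Qed.

Lemma exponential_itv x : 0 < x ->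
  P (Y @^-1` `[0, x]%classic) = (1 - expR (- (rate * x)))%:E.
Proof.
move=> x0; have := lawY (measurable_itv `[0, x]).
by rewrite /distribution /pushforward => ->; rewrite exponential_prob_itv0c// mulNr.
Qed.

Lemma exponential_negative : P [set w | (Y w < 0)%R] = 0%E.
Proof.
have := lawY (measurable_itv `]-oo, 0[); rewrite /distribution /pushforward.
have -> : Y @^-1` `]-oo, 0[%classic = [set w | Y w < 0].
  by apply/seteqP; split=> w; rewrite /= in_itv.
move=> ->; apply: integral0_eq => x /=; rewrite in_itv/= => x0.
by rewrite lt0_exponential_pdf.
Qed.

Lemma exponential_lt x : 0 < x ->
  (P [set w | (Y w < x)%R] <= (1 - expR (- (rate * x)))%:E)%E.
Proof.
move=> x0; rewrite -[X in X%:E]add0r.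
have mI : measurable (Y @^-1` `[0, x]%classic).
  by rewrite -[X in measurable X]setTI; exact: measurable_funP.
apply: (@le_trans _ _ (P ([set w | (Y w < 0)%R] `|` Y @^-1` `[0, x]%classic))).
  apply: le_measure; rewrite ?inE.
  - exact: exponential_measurable_lt.
  - by apply: measurableU => //; exact: exponential_measurable_lt.
  - move=> w /= Yx; rewrite in_itv/=.
    by have [Y0|Y0] := ltP (Y w) 0; [left|right; rewrite ltW].
apply: probability_setU_le => //; first exact: exponential_measurable_lt.
  by rewrite exponential_negative.
by rewrite exponential_itv.
Qed.

Lemma exponential_gt x : 0 < x ->
  (P [set w | (x < Y w)%R] <= (expR (- (rate * x)))%:E)%E.
Proof.
move=> x0; have mI : measurable (Y @^-1` `[0, x]%classic).
  by rewrite -[X in measurable X]setTI; exact: measurable_funP.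
apply: (@le_trans _ _ (P (~` (Y @^-1` `[0, x]%classic)))).
  apply: le_measure; rewrite ?inE.
  - exact: exponential_measurable_gt.
  - exact: measurableC.
  - by move=> w /= xY; rewrite in_itv/= => /andP[_]; rewrite leNgt xY.
rewrite probability_setC// exponential_itv// -EFinB lee_fin; lra.
Qed.

End exponential.
End UniformExponential.

(** The image of [1/4, 3/4] lies outside the cap, the cosine being nonpositive there. *)
Lemma uniform_on_circle_half {d : measure_display} {W : measurableType d}
    {R : realType} (P : probability W R) (X : {RV P >-> (R * R)%type}) :
  uniform_on_circle P X -> (P (X @^-1` cap 0 0) <= (1/2)%:E)%E.
Proof.
move=> uX.
have mcap : measurable (~` cap (0 : R) 0) by apply: measurableC; exact: measurable_cap.
have -> : X @^-1` cap 0 0 = ~` (X @^-1` (~` cap 0 0)).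
  by rewrite preimage_setC setCK.
have -> : 1/2 = 1 - 1/2 :> R by field.
apply: probability_setC_le; first by rewrite -[X in measurable X]setTI; exact: measurable_funP.
have -> : 1/2 = 3/4 - 1/4 :> R by field.
apply: (uniform_on_circle_ge uX mcap); [lra|lra|lra|] => u /andP[u1 u3].
rewrite /setC/= => /cap_circle_pt; rewrite subr0; apply/negP; rewrite -leNgt.
have -> : 2 * pi * u = 2 * pi * (u - 1/2) + pi by field.
rewrite cosDpi oppr_le0; apply: cos_ge0_pihalf.
have pi0 := @pi_gt0 R.
have -> : 2 * pi * (u - 1 / 2) = pi * (2 * u - 1) by field.
apply/andP; split.
  by rewrite -mulrN ler_pM2l//; lra.
by rewrite ler_pM2l//; lra.
Qed.

(** * The Poisson model *)

Section UpdateTimes.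
Context {d : measure_display} {W : measurableType d} {R : realType}.
Variables (C : nat -> W -> R * R) (Y : nat -> W -> R) (w : W).
Hypothesis Y0 : forall k, 0 <= Y k w.

Lemma update_timeS j : update_time Y j.+1 w = update_time Y j w + Y j w.
Proof. by rewrite /update_time big_ord_recr. Qed.

Lemma update_time0 : update_time Y 0 w = 0.
Proof. by rewrite /update_time big_ord0. Qed.

Lemma le_update_time i j : (i <= j)%N -> update_time Y i w <= update_time Y j w.
Proof.
elim: j => [|j ih]; first by rewrite leqn0 => /eqP ->.
rewrite leq_eqVlt ltnS => /predU1P[->//|/ih ij].
by rewrite update_timeS (le_trans ij)// lerDl.
Qed.

Lemma update_time_locate n (t : R) : 0 <= t -> t < update_time Y n w ->
  exists2 j, (j < n)%N & update_time Y j w <= t < update_time Y j.+1 w.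
Proof.
move=> t0; elim: n => [|n ih] tn.
  by move: tn; rewrite update_time0 ltNge t0.
have [tT|Tt] := ltP t (update_time Y n w).
  by have [j jn jt] := ih tT; exists j => //; exact: ltnW.
by exists n => //; rewrite Tt tn.
Qed.

Lemma update_time_unique i j (t : R) :
  update_time Y i w <= t < update_time Y i.+1 w ->
  update_time Y j w <= t < update_time Y j.+1 w -> i = j.
Proof.
wlog ij : i j / (i <= j)%N => [wl hi hj|].
  by have [ij|/ltnW ji] := leqP i j; [exact: wl|apply/esym/wl].
move: ij; rewrite leq_eqVlt => /predU1P[//|ij].
move=> /andP[_ ti] /andP[jt _].
by have := lt_le_trans ti (le_trans (le_update_time ij) jt); rewrite ltxx.
Qed.

Lemma poisson_position_on_interval j (t : R) :
  update_time Y j w <= t < update_time Y j.+1 w ->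
  poisson_position C Y t w = C j w.
Proof.
move=> jt; rewrite /poisson_position; case: xgetP => [q _ [i it <-]|/(_ (C j w))].
  by rewrite (update_time_unique it jt).
by case; exists j.
Qed.

Lemma update_time_block q j s (x : R) : (s < q)%N -> x <= Y (j + s)%N w ->
  update_time Y j w + x <= update_time Y (j + q) w.
Proof.
move=> sq xY; apply: (le_trans _ (le_update_time (_ : j + s.+1 <= j + q)%N)).
  by rewrite addnS update_timeS lerD// le_update_time// leq_addr.
by rewrite leq_add2l.
Qed.

Lemma update_time_blocks L q (x : R) :
  (forall r, (r < L)%N -> exists2 s, (s < q)%N & x <= Y (r * q + s)%N w) ->
  L%:R * x <= update_time Y (L * q) w.
Proof.
elim: L => [|L ih] blk; first by rewrite mul0r mul0n update_time0.
have [s sq xY] := blk L (ltnSn L).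
rewrite mulSn addnC -natr1 mulrDl mul1r.
apply: (le_trans _ (update_time_block sq xY)); rewrite lerD2r.
by apply: ih => r rL; apply: blk; exact: ltnW.
Qed.

Lemma update_time_short q j (x : R) : (forall k, (k < q)%N -> Y (j + k)%N w <= x) ->
  update_time Y (j + q) w <= update_time Y j w + q%:R * x.
Proof.
elim: q => [|q ih] short; first by rewrite addn0 mul0r addr0.
rewrite addnS update_timeS -natr1 mulrDl mul1r addrA lerD ?short//.
by apply: ih => k kq; apply: short; exact: ltnW.
Qed.

End UpdateTimes.

Section PoissonModel.
Context {d : measure_display} {W : measurableType d} {R : realType}.
Variables (P : probability W R) (rate : nat -> R).
Variables (C : nat -> nat -> {RV P >-> (R * R)%type}).
Variables (Y : nat -> nat -> {RV P >-> R}).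

Definition position_or_waiting (k : (nat * nat) + (nat * nat)) : set (set W) :=
  match k with
  | inl (i, j) => sigma_of (C i j)
  | inr (i, j) => sigma_of (Y i j)
  end.

Hypothesis lawC : forall i j, uniform_on_circle P (C i j).
Hypothesis lawY : forall i j (A : set R), measurable A ->
  distribution P (Y i j) A = exponential_prob (rate i) A.
Hypothesis indCY : mutually_independent P position_or_waiting.

Lemma sigma_of_preimage d' (S : measurableType d') (X : W -> S) (A : set S) :
  measurable A -> sigma_of X (X @^-1` A).
Proof.
by move=> mA; exists A => //; rewrite setTI.
Qed.

Lemma sigma_of_measurable d' (S : measurableType d') (X : W -> S) :
  measurable_fun setT X -> sigma_of X `<=` measurable.
Proof. by move=> mX _ [A mA <-]; apply: mX. Qed.

Lemma position_or_waiting_measurable k : position_or_waiting k `<=` measurable.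
Proof.
by case: k => -[i j]; apply: sigma_of_measurable; exact: measurable_funP.
Qed.

Lemma sigma_of_setT d' (S : measurableType d') (X : W -> S) : sigma_of X setT.
Proof. exact: (sigma_of_preimage X measurableT). Qed.

Lemma sigma_of_setI d' (S : measurableType d') (X : W -> S) :
  setI_closed (sigma_of X).
Proof.
move=> _ _ [A mA <-] [B mB <-]; exists (A `&` B); first exact: measurableI.
by rewrite preimage_setI !setTI.
Qed.

Lemma position_or_waiting_setT k : position_or_waiting k setT.
Proof. by case: k => -[i j]; exact: sigma_of_setT. Qed.

Lemma position_or_waiting_setI k : setI_closed (position_or_waiting k).
Proof. by case: k => -[i j]; exact: sigma_of_setI. Qed.

Lemma waiting_lt i j (x : R) :
  position_or_waiting (inr (i, j)) [set w | Y i j w < x].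
Proof.
have -> : [set w | Y i j w < x] = Y i j @^-1` `]-oo, x[%classic.
  by apply/seteqP; split=> w; rewrite /= in_itv.
exact: sigma_of_preimage.
Qed.

Lemma position_preimage i j (A : set (R * R)) : measurable A ->
  position_or_waiting (inl (i, j)) (C i j @^-1` A).
Proof. exact: sigma_of_preimage. Qed.

(** [A j] stands for a failure at update [j]: a block of [q] consecutive updates fails only when all
    of them do, which independence makes exponentially unlikely in [q]. *)
Definition failing_block L q (A : nat -> set W) : set W :=
  \bigcup_(r : 'I_L) \bigcap_(s : 'I_q) A (r * q + s)%N.

Lemma measurable_failing_block L q (A : nat -> set W) :
  (forall j, measurable (A j)) -> measurable (failing_block L q A).
Proof.
move=> mA; apply: measurable_bigcup_fintype => r.
exact: measurable_bigcap_fintype.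
Qed.

Lemma failing_blockP L q (A : nat -> set W) w : ~ failing_block L q A w ->
  forall r, (r < L)%N -> exists2 s, (s < q)%N & ~ A (r * q + s)%N w.
Proof.
move=> nA r rL; apply: contrapT => none; apply: nA.
exists (Ordinal rL) => // s _; apply: contrapT => nAs.
by apply: none; exists s.
Qed.

Lemma failing_block_le L q (f : nat -> (nat * nat) + (nat * nat))
    (A : nat -> set W) (r : R) :
  injective f -> (forall j, position_or_waiting (f j) (A j)) ->
  (forall j, (P (A j) <= r%:E)%E) ->
  (P (failing_block L q A) <= (L%:R * r ^+ q)%:E)%E.
Proof.
move=> inj_f FA PA; rewrite -[in leRHS](card_ord L).
have mA j : measurable (A j) by exact: position_or_waiting_measurable (FA j).
apply: probability_bigcup_le => [b|b]; first exact: measurable_bigcap_fintype.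
rewrite -[in leRHS](card_ord q).
apply: (independent_bigcap_le indCY (f := fun s : 'I_q => f (b * q + s)%N)) => //.
by move=> s s' /inj_f /addnI /ord_inj.
Qed.

Lemma failing_block_waiting i L q (x : R) : 0 < x -> rate i * x <= 1 ->
  (P (failing_block L q (fun j => [set w | (Y i j w < x)%R])) <=
   (L%:R * (1 - expR (-1)) ^+ q)%:E)%E.
Proof.
move=> x0 rx; apply: (failing_block_le _ _ (f := fun j => inr (i, j))).
- by move=> j j' [].
- by move=> j; exact: waiting_lt.
- move=> j; apply: (le_trans (exponential_lt (@lawY i j) x0)).
  by rewrite lee_fin lerD2l lerN2 ler_expR lerN2.
Qed.

(** Exponential variables may be negative on a null set; on this event the update times of all
    centers are monotone. *)
Definition nonneg_waiting : set W := \bigcap_i \bigcap_j [set w | 0 <= Y i j w].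

Lemma nonneg_waitingP w : nonneg_waiting w -> forall i j, 0 <= Y i j w.
Proof. by move=> w0 i j; exact: w0. Qed.

Lemma measurable_nonneg_waiting : measurable nonneg_waiting.
Proof.
apply: bigcapT_measurable => i; apply: bigcapT_measurable => j.
have -> : [set w | 0 <= Y i j w] = ~` [set w | Y i j w < 0].
  by apply/seteqP; split=> w /=; rewrite leNgt => /negP.
by apply: measurableC; exact: exponential_measurable_lt.
Qed.

Lemma probability_nonneg_waiting : P (~` nonneg_waiting) = 0%E.
Proof.
apply/negligibleP; first by apply: measurableC; exact: measurable_nonneg_waiting.
apply: (@negligibleS _ _ _ _ (\bigcup_i \bigcup_j [set w | Y i j w < 0])).
  move=> w nw; apply: contrapT => h; apply: nw => i _ j _ /=.
  by rewrite leNgt; apply/negP => ij; apply: h; exists i => //; exists j.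
apply: negligible_bigcup => i; apply: negligible_bigcup => j.
apply/negligibleP; first exact: exponential_measurable_lt.
exact: (exponential_negative (@lawY i j)).
Qed.

Local Notation waiting_sigma :=
  (<<s \bigcup_(k in range (@inr (nat * nat) (nat * nat))) position_or_waiting k >>).

(** * Events determined by the waiting times *)

Section Generated.
Let G := \bigcup_(k in range (@inr (nat * nat) (nat * nat))) position_or_waiting k.
Local Notation S := (g_sigma_algebraType G).

(** [S] is [W] with the sigma-algebra of the waiting times, so that ordinary measurability proofs
    yield membership in [waiting_sigma]. *)
Lemma generated_waiting i j : measurable_fun setT (Y i j : S -> R).
Proof.
move=> _ A mA; rewrite setTI; apply: sub_sigma_algebra.
exists (inr (i, j)); first by exists (i, j).
exact: sigma_of_preimage.
Qed.

Lemma generated_update_time i j :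
  measurable_fun setT (update_time (Y i) j : S -> R).
Proof. by apply: measurable_sum => k; exact: generated_waiting. Qed.

Lemma generated_nonneg_waiting : waiting_sigma nonneg_waiting.
Proof.
have : measurable (nonneg_waiting : set S).
  apply: bigcapT_measurable => i; apply: bigcapT_measurable => j.
  have -> : [set w | 0 <= Y i j w] = Y i j @^-1` `[0, +oo[%classic.
    by apply/seteqP; split=> w; rewrite /= in_itv/= andbT.
  by rewrite -[X in measurable X]setTI; exact: generated_waiting.
by [].
Qed.

Lemma generated_update_time_between i i' i'' j j' j'' :
  waiting_sigma [set w | update_time (Y i) j w <= update_time (Y i') j' w <
                         update_time (Y i'') j'' w].
Proof.
pose b (w : S) := (update_time (Y i) j w <= update_time (Y i') j' w) &&
  (update_time (Y i') j' w < update_time (Y i'') j'' w).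
have mb : measurable_fun setT b.
  apply: measurable_and.
    by apply: measurable_fun_ler; exact: generated_update_time.
  by apply: measurable_fun_ltr; exact: generated_update_time.
have : measurable (setT `&` b @^-1` [set true] : set S) by exact: mb.
by rewrite setTI.
Qed.

Lemma generated_bigcap_fintype (I : finType) (A : I -> set W) :
  (forall i, waiting_sigma (A i)) -> waiting_sigma (\bigcap_i A i).
Proof. exact: (@measurable_bigcap_fintype _ S). Qed.

Lemma generated_setI (A B : set W) :
  waiting_sigma A -> waiting_sigma B -> waiting_sigma (A `&` B).
Proof. exact: (@measurableI _ S). Qed.

Lemma generated_measurable (A : set W) : waiting_sigma A -> measurable A.
Proof.
apply: smallest_sub; first exact: sigma_algebra_measurable.
by move=> X [k _]; exact: position_or_waiting_measurable.
Qed.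

End Generated.

(** * Times at which many centers miss a cap *)

Section AvoidingCap.
Variables (N m L q : nat) (c kappa p x : R).
Hypothesis m0 : (0 < m)%N.
Hypothesis capp : forall i j, (p%:E <= P (C i j @^-1` cap c kappa))%E.
Hypothesis x0 : 0 < x.
Hypothesis ratex : forall n, (n < m)%N -> rate (N + n) * x <= 1.
Hypothesis Lx : 1 < L%:R * x.

Local Notation T n j := (update_time (Y (N + n)) j).
Local Notation clock := ('I_m * 'I_(L * q))%type.
Local Notation locations := {ffun 'I_m -> 'I_(L * q)}.

(* The update [z.2] of the point [N + z.1] occurs when, for every [n], the point
   [N + n] is at its [v n]-th position. *)
Definition locations_at (z : clock) (v : locations) : set W :=
  nonneg_waiting `&`
  \bigcap_(n : 'I_m) [set w | T n (v n) w <= T z.1 z.2 w < T n (v n).+1 w].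

Definition locations_avoid (v : locations) : set W :=
  \bigcap_(n : 'I_m) (C (N + n) (v n) @^-1` (~` cap c kappa)).

(** Splitting according to [v] turns the random numbers of updates into constants; independence can
    then be used for each [v] separately. *)
Definition avoiding_at (z : clock) : set W :=
  \bigcup_v (locations_at z v `&` locations_avoid v).

Lemma locations_at_generated z v : waiting_sigma (locations_at z v).
Proof.
apply: generated_setI; first exact: generated_nonneg_waiting.
apply: generated_bigcap_fintype => n.
exact: generated_update_time_between.
Qed.

Lemma measurable_locations_avoid v : measurable (locations_avoid v).
Proof.
apply: measurable_bigcap_fintype => n.
rewrite -[X in measurable X]setTI; apply: measurable_funP => //.
by apply: measurableC; exact: measurable_cap.
Qed.

Lemma measurable_avoiding_at z : measurable (avoiding_at z).
Proof.
apply: measurable_bigcup_fintype => v; apply: measurableI.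
  apply: generated_measurable; exact: locations_at_generated.
exact: measurable_locations_avoid.
Qed.

Lemma trivIset_locations_at z : trivIset setT (locations_at z).
Proof.
apply/trivIsetP => v v' _ _ vv'; rewrite -subset0 => w [[w0 wv] [_ wv']].
case/eqP: vv'; apply/ffunP => n; apply: val_inj.
exact: (update_time_unique (nonneg_waitingP w0 (N + n)) (wv n I) (wv' n I)).
Qed.

(** [locations_at z v] depends on waiting times only, whereas [locations_avoid v] concerns one
    position of each of [m] distinct centers. *)
Lemma locations_at_avoid_le z v :
  (P (locations_at z v `&` locations_avoid v) <=
   ((1 - p) ^+ m)%:E * P (locations_at z v))%E.
Proof.
rewrite (@independent_generated_bigcap _ _ _ P _ position_or_waiting
  indCY position_or_waiting_measurable position_or_waiting_setT
  position_or_waiting_setI (range inr) _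
  (fun n : 'I_m => inl ((N + n)%N, nat_of_ord (v n)))).
- rewrite muleC lee_wpmul2r// -[in leRHS](card_ord m).
  apply: prode_le_exp => n; rewrite measure_ge0 andTb preimage_setC.
  apply: probability_setC_le; last exact: capp.
  apply: (@position_or_waiting_measurable (inl ((N + n)%N, nat_of_ord (v n)))).
  exact: (position_preimage (N + n) (v n) (measurable_cap c kappa)).
- by move=> n n' [/addnI /ord_inj].
- by move=> n [].
- by move=> n; apply: position_preimage; apply: measurableC; exact: measurable_cap.
- exact: locations_at_generated.
Qed.

(** The events [locations_at z v] are disjoint in [v], so their probabilities add up to at most 1
    and the number of possible [v] does not enter the bound. *)
Lemma avoiding_at_le z : (P (avoiding_at z) <= ((1 - p) ^+ m)%:E)%E.
Proof.
have fin_v : finite_set [set: locations] by exact: finite_finset.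
have mv v : measurable (locations_at z v).
  apply: generated_measurable; exact: locations_at_generated.
have p1 : (0 <= 1 - p)%R.
  rewrite subr_ge0 -lee_fin; apply: (le_trans (capp 0 0)).
  apply: probability_le1; apply: (@position_or_waiting_measurable (inl (0, 0)%N)).
  exact: (position_preimage 0 0 (measurable_cap c kappa)).
rewrite measure_fin_bigcup//; last 2 first.
- apply/trivIsetP => v v' _ _ vv'; rewrite -subset0 => w [[wv _] [wv' _]].
  have /trivIsetP/(_ v v' I I vv') := @trivIset_locations_at z.
  by rewrite -subset0 => /(_ w); apply.
- by move=> v _; apply: measurableI => //; exact: measurable_locations_avoid.
apply: (@le_trans _ _
  (\sum_(v \in [set: locations]) (((1 - p) ^+ m)%:E * P (locations_at z v)))%E).
  by apply: lee_fsum => // v _; exact: locations_at_avoid_le.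
rewrite -ge0_mule_fsumr; last by move=> v.
rewrite -measure_fin_bigcup//; last exact: trivIset_locations_at.
rewrite -[leRHS]mule1 lee_wpmul2l ?lee_fin ?exprn_ge0// probability_le1//.
exact: fin_bigcup_measurable.
Qed.

(** Outside the first two events every center needs more than unit time for its first [L * q]
    updates, so the [m * (L * q)] clocks [z] account for all configurations up to time 1. *)
Definition avoiding : set W :=
  ~` nonneg_waiting `|`
  ((\bigcup_(n : 'I_m) failing_block L q (fun j => [set w | Y (N + n) j w < x]))
   `|` \bigcup_z avoiding_at z).

Lemma measurable_slow (n : nat) :
  measurable (failing_block L q (fun j => [set w | Y (N + n) j w < x])).
Proof. by apply: measurable_failing_block => j; exact: exponential_measurable_lt. Qed.

Lemma measurable_avoiding : measurable avoiding.
Proof.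
apply: measurableU; first exact/measurableC/measurable_nonneg_waiting.
apply: measurableU; apply: measurable_bigcup_fintype.
  by move=> n; exact: measurable_slow.
exact: measurable_avoiding_at.
Qed.

Lemma avoiding_le : (P avoiding <=
  (m%:R * (L%:R * (1 - expR (-1)) ^+ q) + (m * (L * q))%:R * (1 - p) ^+ m)%:E)%E.
Proof.
rewrite -[X in X%:E]add0r; apply: probability_setU_le.
- exact/measurableC/measurable_nonneg_waiting.
- apply: measurableU; apply: measurable_bigcup_fintype.
    by move=> n; exact: measurable_slow.
  exact: measurable_avoiding_at.
- by rewrite probability_nonneg_waiting.
apply: probability_setU_le.
- by apply: measurable_bigcup_fintype => n; exact: measurable_slow.
- exact/measurable_bigcup_fintype/measurable_avoiding_at.
- rewrite -[X in X%:R * _](card_ord m); apply: probability_bigcup_le.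
    by move=> n; exact: measurable_slow.
  by move=> n; apply: failing_block_waiting => //; exact: ratex.
- have -> : (m * (L * q))%N = #|{: clock}| by rewrite card_prod !card_ord.
  apply: probability_bigcup_le; first exact: measurable_avoiding_at.
  exact: avoiding_at_le.
Qed.

(* If every point misses the cap at time [t], then already at the last update
   before [t] every point was at its position at time [t]. *)
Lemma avoiding_cap w (t : R) : 0 <= t <= 1 ->
  (forall n, (n < m)%N ->
    ~ cap c kappa (poisson_position (C (N + n)) (Y (N + n)) t w)) ->
  avoiding w.
Proof.
move=> /andP[t0 t1] miss.
have [w0|] := pselect (nonneg_waiting w); last by left.
have [|fast] := pselect (exists2 n : 'I_m, True &
    failing_block L q (fun j => [set w | Y (N + n) j w < x]) w).
  by move=> [n _ wn]; right; left; exists n.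
right; right.
have loc (n : 'I_m) : exists j : 'I_(L * q), T n j w <= t < T n j.+1 w.
  have tT : t < T n (L * q) w.
    apply: (le_lt_trans t1); apply: (lt_le_trans Lx).
    apply: update_time_blocks => [k|r rL]; first exact: nonneg_waitingP.
    have nf : ~ failing_block L q (fun j => [set w | Y (N + n) j w < x]) w.
      by move=> f; apply: fast; exists n.
    have [s sq /negP] := failing_blockP nf rL.
    by rewrite -leNgt; exists s.
  have [j jn jt] := update_time_locate t0 tT.
  by exists (Ordinal jn).
have [v vP] := choice loc.
have [n0 _ n0P] := @arg_maxP _ _ _ (Ordinal m0) xpredT (fun n => T n (v n) w) isT.
exists (n0, v n0) => //; exists [ffun n => v n] => //; split.
  split=> // n _ /=; rewrite ffunE.
  have /andP[_ tv] := vP n; have /andP[vt _] := vP n0.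
  by apply/andP; split; [exact: (n0P n isT)|exact: le_lt_trans vt tv].
move=> n _; rewrite /= ffunE.
have := miss n (ltn_ord n).
by rewrite (poisson_position_on_interval _ (nonneg_waitingP w0 (N + n)) (vP n)).
Qed.

End AvoidingCap.

Lemma negligible_poisson_avoids_cap (k N : nat) (c kappa : R) :
  (forall n, rate n <= n.+1%:R ^+ k) -> kappa < 1 ->
  P.-negligible [set w | exists2 t, t \in `[0, 1] &
    forall n, (N <= n)%N ->
      ~ cap c kappa (poisson_position (C n) (Y n) t w)].
Proof.
move=> ratek kappa1; have [p p0 pcap] := uniform_on_circle_cap P kappa1.
have capp i j : (p%:E <= P (C i j @^-1` cap c kappa))%E by exact: pcap.
have p1 : p <= 1.
  rewrite -lee_fin; apply: (le_trans (capp 0 0)); apply: probability_le1.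
  apply: (@position_or_waiting_measurable (inl (0, 0)%N)).
  exact: (position_preimage 0 0 (measurable_cap c kappa)).
have g1 : 0 <= 1 - expR (-1 : R) < 1.
  have := expR_gt0 (-1 : R); have : expR (-1 : R) <= 1 by rewrite expR_le1; lra.
  by move=> ? ?; apply/andP; split; lra.
have g2 : 0 <= 1 - p < 1 by apply/andP; split; lra.
apply: negligible_small => e e0.
have [m [L [m0 LE] PmL]] := poisson_horizon k N g1 g2 e0.
(* [Lam] bounds the rates of the centers [N + n] with [n < m], since [N + n + 1 <= N + m]. Taking
   [x = 1 / Lam] and [L = Lam + 1] gives both [rate * x <= 1] and [L * x > 1]. *)
pose Lam := ((N + m) ^ k)%N.
have Lam0 : (0 < Lam%:R :> R) by rewrite ltr0n expn_gt0 addn_gt0 m0 orbT.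
have x0 : 0 < Lam%:R^-1 :> R by rewrite invr_gt0.
have ratex n : (n < m)%N -> rate (N + n) * Lam%:R^-1 <= 1.
  move=> nm; rewrite ler_pdivrMr// mul1r (le_trans (ratek _))//.
  by rewrite natrX lerXn2r ?nnegrE// ler_nat -addnS leq_add2l.
have Lx : 1 < L%:R * Lam%:R^-1 :> R by rewrite ltr_pdivlMr// mul1r ltr_nat LE.
exists (avoiding N m L m c kappa Lam%:R^-1); split.
- exact: measurable_avoiding.
- move=> w [t t01 miss]; have t01' : 0 <= t <= 1 by move: t01; rewrite in_itv.
  apply: (avoiding_cap m m0 Lx t01') => n _; apply: miss; exact: leq_addr.
by apply: (le_trans (avoiding_le L m capp x0 ratex)); rewrite lee_fin.
Qed.

(** * One stage of the nested windows *)

Section Stage.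
Variables (i L q M M' : nat) (x : R).
Hypothesis q0 : (0 < q)%N.
Hypothesis M0 : (0 < M)%N.
Hypothesis M'0 : (0 < M')%N.
Hypothesis x0 : 0 < x.
Hypothesis rate_x : rate i * x = 1.
Hypothesis Lx : 1 < L%:R * x.

Local Notation T j := (update_time (Y i) j).

(* Off this event, each of the [L] blocks of [q] consecutive updates contains a
   position in the good half of the circle and a waiting time at least [x], so
   that the [L * q] updates last more than [L * x > 1]; every block lasts at
   most 1/(4 M), so any window of length 1/M contains a whole block; and a
   position lasting 3/M' covers an interval of the grid of step 1/M'. *)
Definition stage_failure : set W :=
  ~` nonneg_waiting `|`
  (failing_block L q (fun j => C i j @^-1` cap 0 0) `|`
  (failing_block L q (fun j => [set w | Y i j w < x]) `|`
  ((\bigcup_(j : 'I_(L * q)) [set w | (4 * M%:R * q%:R)^-1 < Y i j w]) `|`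
   (\bigcup_(j : 'I_(L * q)) [set w | Y i j w < 3 / M'%:R])))).

Lemma measurable_stage_failure : measurable stage_failure.
Proof.
repeat apply: measurableU.
- exact/measurableC/measurable_nonneg_waiting.
- apply: measurable_failing_block => j.
  apply: (@position_or_waiting_measurable (inl (i, j))).
  exact: (position_preimage i j (measurable_cap 0 0)).
- by apply: measurable_failing_block => j; exact: exponential_measurable_lt.
- by apply: measurable_bigcup_fintype => j; exact: exponential_measurable_gt.
- by apply: measurable_bigcup_fintype => j; exact: exponential_measurable_lt.
Qed.

Lemma stage_failure_le : (P stage_failure <=
  (L%:R * (1/2) ^+ q + (L%:R * (1 - expR (-1)) ^+ q +
   ((L * q)%:R * expR (- (rate i * (4 * M%:R * q%:R)^-1)) +
    (L * q)%:R * (rate i * (3 / M'%:R)))))%:E)%E.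
Proof.
have m1 : measurable (failing_block L q (fun j => C i j @^-1` cap 0 0)).
  apply: measurable_failing_block => j.
  apply: (@position_or_waiting_measurable (inl (i, j))).
  exact: (position_preimage i j (measurable_cap 0 0)).
have m2 : measurable (failing_block L q (fun j => [set w | Y i j w < x])).
  by apply: measurable_failing_block => j; exact: exponential_measurable_lt.
have m3 : measurable (\bigcup_(j : 'I_(L * q)) [set w | (4 * M%:R * q%:R)^-1 < Y i j w]).
  by apply: measurable_bigcup_fintype => j; exact: exponential_measurable_gt.
have m4 : measurable (\bigcup_(j : 'I_(L * q)) [set w | Y i j w < 3 / M'%:R]).
  by apply: measurable_bigcup_fintype => j; exact: exponential_measurable_lt.
rewrite -[X in X%:E]add0r; apply: probability_setU_le.
- exact/measurableC/measurable_nonneg_waiting.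
- by repeat apply: measurableU.
- by rewrite probability_nonneg_waiting.
apply: probability_setU_le => //; first by repeat apply: measurableU.
  apply: (failing_block_le _ _ (f := fun j => inl (i, j))).
  - by move=> j j' [].
  - by move=> j; exact: (position_preimage i j (measurable_cap 0 0)).
  - by move=> j; exact: uniform_on_circle_half.
apply: probability_setU_le => //; first exact: measurableU.
  by apply: failing_block_waiting => //; rewrite rate_x.
rewrite -[in X in (_ <= (X%:R * expR _ + _)%:E)%E](card_ord (L * q)).
rewrite -[in X in (_ <= (_ + X%:R * _)%:E)%E](card_ord (L * q)).
apply: probability_setU_le => //; apply: probability_bigcup_le => j.
- exact: exponential_measurable_gt.
- apply: (exponential_gt (@lawY i j)).
  by rewrite invr_gt0 !mulr_gt0 ?ltr0n.
- exact: exponential_measurable_lt.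
- apply: (le_trans (exponential_lt (@lawY i j) _)); first by rewrite divr_gt0 ?ltr0n.
  by rewrite lee_fin; have := expR_ge1Dx (- (rate i * (3 / M'%:R))); lra.
Qed.

(** The first block starting at or after [a] ends before [a + 1/(2 M)], or at that time. It contains
    a good position, which lasts long enough to cover a whole cell of the finer grid. *)
Lemma stage_success w (a : R) : ~ stage_failure w -> 0 <= a -> a + M%:R^-1 <= 1 ->
  exists r : nat, [/\ a <= r%:R / M'%:R, r.+1%:R / M'%:R <= a + M%:R^-1 &
    forall t, r%:R / M'%:R <= t <= r.+1%:R / M'%:R ->
      ~ cap 0 0 (poisson_position (C i) (Y i) t w)].
Proof.
move=> /not_orP[/contrapT w0 /not_orP[good /not_orP[slow /not_orP[long short]]]] a0 a1.
have Y0 := nonneg_waitingP w0 i.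
have {}long j : (j < L * q)%N -> Y i j w <= (4 * M%:R * q%:R)^-1.
  move=> jL; rewrite leNgt; apply/negP => h; apply: long.
  by exists (Ordinal jL).
have {}short j : (j < L * q)%N -> 3 / M'%:R <= Y i j w.
  move=> jL; rewrite leNgt; apply/negP => h; apply: short.
  by exists (Ordinal jL).
have MR : 0 < M%:R :> R by rewrite ltr0n.
have qR : 0 < q%:R :> R by rewrite ltr0n.
have M'R : 0 < M'%:R :> R by rewrite ltr0n.
have block_short r : (r < L)%N -> T (r * q + q) w <= T (r * q) w + (4 * M%:R)^-1.
  move=> rL.
  have -> : (4 * M%:R)^-1 = q%:R * (4 * M%:R * q%:R)^-1 :> R.
    by field; rewrite !gt_eqF.
  apply: update_time_short => k kq; apply: long.
  by apply: (@leq_trans (r * q + q)); [rewrite ltn_add2l|rewrite -mulSnr leq_mul2r rL orbT].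
have TL : 1 < T (L * q) w.
  apply: (lt_le_trans Lx); apply: update_time_blocks => // r rL.
  have [s sq /negP] := failing_blockP slow rL.
  by rewrite -leNgt; exists s.
have Minv : 0 < M%:R^-1 :> R by rewrite invr_gt0.
have M4 : (4 * M%:R)^-1 = M%:R^-1 / 4 :> R by rewrite invfM mulrC.
have aL : exists r, a <= T (r * q) w by exists L; lra.
(* By minimality the preceding block starts before [a], and it lasts at most 1/(4 M); hence this one
   starts by [a + 1/(4 M)]. It is one of the [L] blocks since the time [T (L * q)] exceeds 1. *)
case: (ex_minnP aL) => r ar rmin.
have rL' : (r <= L)%N by apply: rmin; lra.
have Tr : T (r * q) w <= a + M%:R^-1 / 4.
  case: r ar rmin rL' => [|r] ar rmin rL'.
    by rewrite mul0n update_time0; lra.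
  have Tra : T (r * q) w < a.
    by rewrite ltNge; apply/negP => /rmin; rewrite ltnn.
  by have := block_short r rL'; rewrite -mulSnr M4; lra.
have rL : (r < L)%N.
  rewrite ltn_neqAle rL' andbT; apply/eqP => rE.
  by move: Tr; rewrite rE; lra.
have [s sq ns] := failing_blockP good rL.
pose j := (r * q + s)%N.
have jL : (j < L * q)%N.
  by apply: (@leq_trans (r * q + q)); [rewrite ltn_add2l|rewrite -mulSnr leq_mul2r rL orbT].
have aj : a <= T j w by apply: (le_trans ar); apply: le_update_time => //; exact: leq_addr.
have ja : T j.+1 w <= a + M%:R^-1 / 2.
  apply: (@le_trans _ _ (T (r * q + q) w)).
    by apply: le_update_time => //; rewrite -addnS leq_add2l.
  by have := block_short r rL; rewrite M4; lra.
have jj : T j w + 3 / M'%:R <= T j.+1 w by rewrite update_timeS lerD2l short.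
have Tj0 : 0 <= T j w by lra.
(* The grid point just after [T j] is at distance at most 1/M'. Its cell ends by [T j + 2/M'],
   strictly before [T j.+1], as the half-open holding interval demands. *)
have [r' r'1 r'2] : exists2 r', T j w <= r'%:R / M'%:R & r'%:R / M'%:R <= T j w + 1 / M'%:R.
  exists (Num.truncn (T j w * M'%:R)).+1.
    by rewrite ler_pdivlMr// ltW// truncnS_gt.
  rewrite ler_pdivrMr// mulrDl divfK ?gt_eqF// -natr1 lerD2r.
  by rewrite truncn_le// mulr_ge0// ltW.
have M'inv : 0 < 1 / M'%:R :> R by rewrite divr_gt0.
have r'S : r'.+1%:R / M'%:R = r'%:R / M'%:R + 1 / M'%:R :> R.
  by rewrite -natr1 mulrDl.
have e3 : 3 / M'%:R = 1 / M'%:R + 1 / M'%:R + 1 / M'%:R :> R by rewrite -!mulrDl; congr (_ / _); ring.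
exists r'; split; [lra|lra|] => t /andP[t1 t2].
rewrite (@poisson_position_on_interval _ _ _ _ _ _ Y0 j)//.
by apply/andP; split; lra.
Qed.

End Stage.

End PoissonModel.

Section PoissonDense.
Context {d : measure_display} {W : measurableType d} {R : realType}.
Variable P : probability W R.

Lemma circle_poisson_position (C : nat -> W -> R * R) Y t w :
  (forall j, circle (C j w)) -> circle (poisson_position C Y t w).
Proof.
move=> Ccirc; rewrite /poisson_position; case: xgetP => [q _ [j _ <-]|_] //.
by exists 0.
Qed.

Lemma negligible_exceptional_poisson (ell : nat -> R) (alpha : R)
    (U : nat -> R -> W -> R * R) (k : nat) :
  (forall n, 0 < ell n) -> (forall n, ell n `^ (- alpha) <= n.+1%:R ^+ k) ->
  poisson_model P ell alpha U ->
  P.-negligible [set w | exceptional_times ell U w !=set0].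
Proof.
move=> ell0 ratek [C [Y [Ccirc lawC lawY indCY UE]]].
apply: negligible_exceptional_times => //.
  by move=> n t w t0; rewrite UE//; exact: circle_poisson_position.
move=> N c kappa kappa1.
apply: negligibleS (negligible_poisson_avoids_cap lawC lawY indCY N c ratek kappa1).
move=> w [t t01 miss]; exists t => // n Nn.
by rewrite -UE; [exact: miss|move: t01; rewrite in_itv => /andP[]].
Qed.

Lemma poisson_rate_le (ell : nat -> R) (alpha c : R) : 0 < alpha ->
  (forall n, 0 < ell n) -> (forall n, ell n >= 1 / n.+1%:R `^ c) ->
  exists k, forall n, ell n `^ (- alpha) <= n.+1%:R ^+ k.
Proof.
(* The degree is a natural number above [c * alpha]; for negative [c] the truncation is 0 and the
   comparison still holds. *)
move=> alpha0 ell0 ellc; exists (Num.truncn (c * alpha)).+1 => n.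
have c0 : 0 < (n.+1%:R : R) `^ c by rewrite powR_gt0.
rewrite powRN; apply: (@le_trans _ _ (n.+1%:R `^ c `^ alpha)).
  rewrite -[leLHS]mul1r ler_pdivrMr ?powR_gt0// mulrC -powRM ?(ltW c0) ?(ltW (ell0 n))//.
  have e1 : 1 `^ alpha = 1 :> R by rewrite powR1.
  rewrite -[leLHS]e1.
  apply: ge0_ler_powR; rewrite ?nnegrE ?(ltW alpha0)//.
    by rewrite mulr_ge0 ?(ltW c0) ?(ltW (ell0 n)).
  have := ellc n; rewrite ler_pdivrMr//.
rewrite -powRrM -powR_mulrn//; apply: ler_powR; first by rewrite ler1n.
exact/ltW/truncnS_gt.
Qed.

End PoissonDense.

(** * Sparse lengths *)

Section SparseSequence.
Context {R : realType}.
Variables (alpha : R) (s : nat -> nat * nat).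
Hypothesis alpha0 : 0 < alpha.
Hypothesis s_incr : forall k, ((s k).1 < (s k.+1).1)%N.

(** Inverts the relation between length and rate, so that the [k]-th center has the rate prescribed
    by stage [k]. *)
Definition sparse_length (k : nat) : R := ((s k.+1).1 ^ 2)%:R `^ (- alpha^-1).

Lemma sparse_index k : (k < (s k.+1).1)%N.
Proof. by elim: k => [|k ih]; apply: leq_ltn_trans (s_incr _). Qed.

Lemma sparse_square_gt0 k : 0 < ((s k.+1).1 ^ 2)%:R :> R.
Proof. by rewrite ltr0n expn_gt0 (leq_ltn_trans _ (sparse_index k)). Qed.

Lemma sparse_length_gt0 k : 0 < sparse_length k.
Proof. by rewrite powR_gt0// sparse_square_gt0. Qed.

Lemma sparse_length_rate k :
  sparse_length k `^ (- alpha) = ((s k.+1).1 ^ 2)%:R.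
Proof.
by rewrite /sparse_length -powRrM mulrNN mulVf ?gt_eqF// powRr1.
Qed.

Lemma sparse_length_decreasing : decreasing_seq sparse_length.
Proof.
apply/decreasing_seqP => k; rewrite /sparse_length !powRN ltf_pV2 ?posrE ?powR_gt0 ?sparse_square_gt0//.
apply: gt0_ltr_powR; rewrite ?nnegrE ?invr_gt0//.
by rewrite ltr_nat ltn_exp2r.
Qed.

Lemma sparse_length_cvg0 : sparse_length n @[n --> \oo] --> 0.
Proof.
apply/cvgrPdist_le => e e0; exists (Num.truncn (e `^ (- alpha))).+1 => // n /= en.
rewrite sub0r normrN ger0_norm ?(ltW (sparse_length_gt0 n))//.
have e1 : e = (e `^ (- alpha)) `^ (- alpha^-1).
  by rewrite -powRrM mulrNN mulfV ?gt_eqF// powRr1// ltW.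
rewrite [leRHS]e1 /sparse_length !(powRN _ alpha^-1) lef_pV2 ?posrE ?powR_gt0 ?sparse_square_gt0//.
apply: ge0_ler_powR; rewrite ?nnegrE ?invr_ge0 ?powR_ge0 ?(ltW alpha0)//.
apply: (le_trans (ltW (truncnS_gt _))); rewrite ler_nat (leq_trans en)//.
by rewrite (leq_trans (ltnW (sparse_index n)))// -[leqLHS]expn1 leq_pexp2l// (leq_ltn_trans _ (sparse_index n)).
Qed.

End SparseSequence.

Section SparseTimes.
Context {R : realType}.

Lemma open_cap (c kappa : R) : open (cap c kappa).
Proof.
pose f (q : R * R) := 2 * pi * (q.1 * cos (2 * pi * c) + q.2 * sin (2 * pi * c)).
have -> : cap c kappa = f @^-1` [set y | kappa < y] by [].
apply: open_comp; last exact: open_gt.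
move=> q _; apply: cvgM; first exact: cvg_cst.
apply: cvgD; (apply: cvgM; last exact: cvg_cst).
  exact: cvg_fst.
exact: cvg_snd.
Qed.

(** From some index on, the centers have nonpositive cosine and the arcs are short, so their points
    have cosine below 1/2: they miss a neighbourhood of [circle_pt 0]. *)
Lemma not_dense_missing_cap (p : nat -> R * R) (ell : nat -> R) (K : nat) :
  ell n @[n --> \oo] --> 0 -> (forall n, (K <= n)%N -> ~ cap 0 0 (p n)) ->
  ~ dense_in_circle (lim_sup_set (fun n => Defs.arc (p n) (ell n))).
Proof.
move=> ell0 miss dense.
(* A cosine above 7/8 forces the squared sine below 15/64, hence the sine below 1/2 in absolute
   value. *)
have k1 : 7/8 < 1 :> R by lra.
have [s /andP[s0 _] sP] := cos2pi_gt_near_int k1.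
have [N _ NP] : \forall n \near \oo, ell n < s by exact: (cvgr_lt _ ell0).
have := dense (circle_pt 0) (ex_intro2 _ _ 0 I erefl).
rewrite closureEonbhs => /(_ (lim_sup_set (fun n => Defs.arc (p n) (ell n))) (cap 0 (1/2))).
case=> //.
  split; first exact: open_cap.
  apply/cap_circle_pt; rewrite subr0 mulr0 cos0; lra.
move=> q [Eq capq].
have [n /= nKN [u [v [up vq uv]]]] := Eq (maxn K N) I.
have nK : (K <= n)%N by rewrite (leq_trans _ nKN)// leq_maxl.
have nN : (N <= n)%N by rewrite (leq_trans _ nKN)// leq_maxr.
have ells := NP n nN.
have := miss n nK; rewrite -up cap_circle_pt subr0 => /negP; rewrite -leNgt => cu.
move: capq; rewrite -vq => /cap_circle_pt; rewrite subr0.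
have vs : `|v - u| < s by lra.
have := sP (v - u) 0; rewrite subr0 => /(_ vs) ch.
have -> : 2 * pi * v = 2 * pi * u + 2 * pi * (v - u).
  by rewrite -(mulrDr (2 * pi)) addrC subrK.
rewrite cosD; set cu' := cos (2 * pi * u) in cu *; set ch' := cos (2 * pi * (v - u)) in ch *.
have := sin_max (2 * pi * u); set su := sin (2 * pi * u).
have := cos2Dsin2 (2 * pi * (v - u)); rewrite -/ch'; set sh := sin (2 * pi * (v - u)).
move=> csh /ler_normlP[su1 su2] big.
have sh1 : `|sh| < 1/2.
  rewrite ltNge; apply/negP => sh2.
  have : (1/2) ^+ 2 <= `|sh| ^+ 2 by rewrite lerXn2r ?nnegrE//; lra.
  by rewrite real_normK ?num_real//; nra.
have shsu : `|su * sh| <= `|sh|.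
  by rewrite normrM ler_piMl// ler_norml; apply/andP; split; lra.
have cc : cu' * ch' <= 0 by rewrite mulr_le0_ge0//; lra.
have := ler_norm (- (su * sh)); rewrite normrN; lra.
Qed.

End SparseTimes.

Section SparsePoisson.
Context {R : realType}.

Lemma negligible_limsup_half {d : measure_display} {W : measurableType d}
    (P : probability W R) (B : nat -> set W) :
  (forall k, measurable (B k)) -> (forall k, (P (B k) <= ((1/2) ^+ k)%:E)%E) ->
  P.-negligible (lim_sup_set B).
Proof.
move=> mB PB; apply/negligibleP.
  apply: bigcapT_measurable => n; exact: bigcup_measurable.
apply: lim_sup_set_cvg0 => //.
apply: (@le_lt_trans _ _ (2 : R)%:E); last exact: ltry.
have two0 : 0 <= 2 :> R by [].
(* The geometric series is written with terms 2/2^(k+1). *)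
apply: (le_trans _ (epsilon_trick0 xpredT two0)).
apply: lee_nneseries => k _ //=; apply: (le_trans (PB k)); rewrite lee_fin.
by rewrite expr_div_n expr1n natrX exprS invfM mulrA divff// mul1r div1r.
Qed.

Lemma sparse_poisson_exceptional (alpha : R) : 0 < alpha ->
  exists ell : nat -> R, [/\ lengths ell, decreasing_seq ell &
    forall (d : measure_display) (W : measurableType d) (P : probability W R)
      (U : nat -> R -> W -> R * R),
    poisson_model P ell alpha U ->
    {ae P, forall w, exceptional_times ell U w !=set0}].
Proof.
move=> alpha0; have [s sP] := stage_sequence R.
have s_incr k : ((s k).1 < (s k.+1).1)%N by have [] := sP k.
have s2 k : (0 < (s k).2)%N by have [] := sP k.
exists (sparse_length alpha s); split.
- split; [exact: sparse_length_gt0| |].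
    apply/nonincreasing_seqP => k; apply: ltW.
    by move/decreasing_seqP: (sparse_length_decreasing alpha0 s_incr).
  exact: sparse_length_cvg0.
- exact: sparse_length_decreasing.
move=> d W P U [C [Y [Ccirc lawC lawY indCY UE]]].
pose q k := (s k.+1).1.
have q0 k : (0 < q k)%N by exact: leq_ltn_trans (sparse_index s_incr k).
have qR k : 0 < (q k ^ 2)%:R :> R by rewrite ltr0n expn_gt0 q0.
(* Stage [k] uses rate [q k ^ 2], threshold [x] equal to the mean waiting time, and one block more
   than the rate, which makes [L * x > 1]. *)
pose B k := stage_failure C Y k (q k ^ 2).+1 (q k) (s k).2 (s k.+1).2 ((q k ^ 2)%:R^-1).
have lawY' i j (A : set R) : measurable A ->
    distribution P (Y i j) A = exponential_prob ((q i ^ 2)%:R) A.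
  by move=> mA; rewrite -(sparse_length_rate s alpha0); exact: lawY.
have BP k : (P (B k) <= ((1/2) ^+ k)%:E)%E.
  have rx : (q k ^ 2)%:R * (q k ^ 2)%:R^-1 = 1 :> R by rewrite divff// gt_eqF.
  have x0 : 0 < (q k ^ 2)%:R^-1 :> R by rewrite invr_gt0.
  apply: (le_trans (@stage_failure_le _ _ _ P (fun i => (q i ^ 2)%:R) C Y
     lawC lawY' indCY k _ _ _ _ _ (q0 k) (s2 k) (s2 k.+1) x0 rx)).
  by rewrite lee_fin; have [_ _] := sP k.
have mB k : measurable (B k) by exact: measurable_stage_failure.
apply: negligibleS (negligible_limsup_half mB BP).
move=> w /= nw; apply: contrapT => /existsNP[K /not_implyP[_ nB]]; apply: nw.
have {}nB k : (K <= k)%N -> ~ B k w by move=> Kk Bk; apply: nB; exists k.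
pose a k (r : nat) : R := r%:R / (s k).2%:R.
pose b k (r : nat) : R := r.+1%:R / (s k).2%:R.
have ab k r : a k r + (s k).2%:R^-1 = b k r.
  by rewrite /a /b -natr1 mulrDl mul1r.
pose good k r r' := [/\ a k r <= a k.+1 r', b k.+1 r' <= b k r &
  forall t, a k.+1 r' <= t <= b k.+1 r' -> ~ cap 0 0 (poisson_position (C k) (Y k) t w)].
(* The value 0 is a placeholder before stage [K] or for a cell leaving [0, 1]. *)
have /choice[g gP] : forall kr : nat * nat, exists r',
    (K <= kr.1)%N -> b kr.1 kr.2 <= 1 -> good kr.1 kr.2 r'.
  move=> [k r] /=; have [Kk|nKk] := boolP (K <= k)%N; last by exists 0%N.
  have [b1|nb1] := boolP (b k r <= 1); last by exists 0%N.
  have a0 : 0 <= a k r by apply: divr_ge0; exact: ler0n.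
  have Lx : 1 < (q k ^ 2).+1%:R * (q k ^ 2)%:R^-1 :> R.
    by rewrite ltr_pdivlMr// mul1r ltr_nat.
  have b1' : a k r + (s k).2%:R^-1 <= 1 by rewrite ab.
  have [r' [r1 r2 r3]] := stage_success (q0 k) (s2 k) (s2 k.+1) Lx (nB k Kk) a0 b1'.
  by exists r' => _ _; split=> //; rewrite -(ab k r).
(* The nesting starts at stage [K] with the first cell of its grid; every later cell lies inside it,
   hence inside [0, 1]. *)
pose r := fix r n : nat := if n is n'.+1 then g ((K + n')%N, r n') else 0%N.
have r_good n : b (K + n)%N (r n) <= 1 /\
    good (K + n)%N (r n) (r n.+1).
  elim: n => [|n [b1 [_ b2 _]]].
    have b1 : b (K + 0)%N (r 0%N) <= 1.
      by rewrite /b /= ler_pdivrMr ?ltr0n// mul1r ler_nat.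
    by split=> //; apply: (gP ((K + 0)%N, r 0%N)) => //; rewrite leq_addr.
  have b1' : b (K + n.+1)%N (r n.+1) <= 1 by rewrite addnS (le_trans b2).
  by split=> //; apply: (gP ((K + n.+1)%N, r n.+1)) => //; rewrite leq_addr.
have [t tP] : exists t, forall n, a (K + n)%N (r n) <= t <= b (K + n)%N (r n).
  apply: nested_intervals => n.
  - by have [_ []] := r_good n; rewrite addnS.
  - by have [_ []] := r_good n; rewrite addnS.
  - by rewrite -ab lerDl invr_ge0 ler0n.
have t01 : 0 <= t <= 1.
  have [b1 _] := r_good 0%N; have /andP[at0 tb] := tP 0%N.
  rewrite (le_trans tb b1) andbT (le_trans _ at0)//.
  by apply: divr_ge0; exact: ler0n.
have t0 : 0 <= t by case/andP: t01.
exists t; split; first by rewrite in_itv.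
apply: (not_dense_missing_cap (K := K)); first exact: sparse_length_cvg0.
(* The [k]-th center is controlled on the window of stage [k + 1], hence the successor in the use of
   [tP]. *)
move=> k Kk; rewrite UE// -(subnKC Kk).
have [_ [_ _]] := r_good (k - K)%N; apply.
by have := tP (k - K).+1; rewrite addnS.
Qed.

End SparsePoisson.

(** * Brownian motion *)

Section GaussianTail.
Context {R : realType}.

Lemma expRN_le_cube (u : R) : 0 < u -> expR (- u) <= 6 / u ^+ 3.
Proof.
move=> u0; rewrite expRN -[leRHS]invf_div lef_pV2 ?posrE ?expR_gt0 ?divr_gt0 ?exprn_gt0//.
by apply: (le_trans _ (expR_ge1Dxn 2 (ltW u0))); rewrite lerDr.
Qed.

(* Comparing with the density of standard deviation [2 s], whose integral over
   the tail is at most 1, spares the evaluation of an improper integral. *)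
Lemma normal_pdf_tail (s y x : R) : 0 < s -> 0 < y -> y < `|x| ->
  normal_pdf 0 s x <= 2 * expR (- (y ^+ 2 / (4 * s ^+ 2))) * normal_pdf 0 (2 * s) x.
Proof.
move=> s0 y0 yx.
have s20 : 0 < 2 * s by rewrite mulr_gt0.
rewrite !normal_pdfE ?gt_eqF// /normal_peak /normal_fun !subr0.
have -> : Num.sqrt ((2 * s) ^+ 2 * pi *+ 2) = 2 * Num.sqrt (s ^+ 2 * pi *+ 2) :> R.
  have -> : (2 * s) ^+ 2 * pi *+ 2 = 2 ^+ 2 * (s ^+ 2 * pi *+ 2) :> R.
    by rewrite exprMn -mulrA -mulrnAr.
  by rewrite sqrtrM ?exprn_ge0// sqrtr_sqr ger0_norm.
set c := Num.sqrt _.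
have c0 : 0 <= c^-1 by rewrite invr_ge0 sqrtr_ge0.
rewrite (invfM 2 c); have -> (k ci h : R) : 2 * k * (2^-1 * ci * h) = ci * (k * h) by field.
rewrite ler_wpM2l// -expRD ler_expR.
have x2 : y ^+ 2 <= x ^+ 2.
  by rewrite -[x ^+ 2]real_normK ?num_real// lerXn2r ?nnegrE ?(ltW y0)// ltW.
have s2 : 0 < s ^+ 2 by rewrite exprn_gt0.
rewrite -(mulr_natr (s ^+ 2)) -(mulr_natr ((2 * s) ^+ 2)) exprMn.
have -> : - x ^+ 2 / (s ^+ 2 * 2) = - (x ^+ 2 / s ^+ 2) / 2 by field; rewrite gt_eqF.
have -> : - x ^+ 2 / (2 ^+ 2 * s ^+ 2 * 2) = - (x ^+ 2 / s ^+ 2) / 8 by field; rewrite gt_eqF.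
have -> : y ^+ 2 / (4 * s ^+ 2) = (y ^+ 2 / s ^+ 2) / 4 by field; rewrite gt_eqF.
have : y ^+ 2 / s ^+ 2 <= x ^+ 2 / s ^+ 2 by rewrite ler_pM2r ?invr_gt0.
have : 0 <= y ^+ 2 / s ^+ 2 by rewrite divr_ge0 ?exprn_ge0// ltW.
lra.
Qed.

Lemma measurable_abs_gt (y : R) : measurable [set x : R | y < `|x|].
Proof.
have -> : [set x : R | y < `|x|] = (fun x => `|x|) @^-1` `]y, +oo[%classic.
  by apply/seteqP; split=> x; rewrite /= in_itv/= andbT.
rewrite -[X in measurable X]setTI; apply: continuous_measurable_fun => //.
exact: norm_continuous.
Qed.

(** A sixth-power tail suffices: for an increment it is cubic in the duration and so beats the
    number of dyadic intervals. The constant is 2 times 6 times 4^3. *)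
Lemma normal_prob_tail (s y : R) : 0 < s -> 0 < y ->
  (normal_prob 0 s [set x | (y < `|x|)%R] <= (768 * s ^+ 6 / y ^+ 6)%:E)%E.
Proof.
move=> s0 y0; pose c := 2 * expR (- (y ^+ 2 / (4 * s ^+ 2))).
have c0 : 0 <= c by rewrite mulr_ge0// expR_ge0.
have mD := measurable_abs_gt y.
have mpdf t : measurable_fun [set x : R | y < `|x|] (fun x => (normal_pdf 0 t x)%:E).
  by apply/measurable_EFinP; apply: measurable_funTS; exact: measurable_normal_pdf.
apply: (@le_trans _ _ (c%:E * normal_prob 0 (2 * s) [set x | (y < `|x|)%R])%E).
  rewrite /normal_prob -ge0_integralZl ?lee_fin//; last 2 first.
    exact: mpdf.
    by move=> x _; rewrite lee_fin normal_pdf_ge0.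
  apply: ge0_le_integral => //.
  - by move=> x _; rewrite lee_fin normal_pdf_ge0.
  - exact: mpdf.
  - by apply: measurable_funeM; exact: mpdf.
  - by move=> x yx; rewrite -EFinM lee_fin normal_pdf_tail.
apply: (@le_trans _ _ (c%:E * 1)%E).
  by apply: lee_wpmul2l; rewrite ?lee_fin// probability_le1.
rewrite mule1 lee_fin /c.
have u0 : 0 < y ^+ 2 / (4 * s ^+ 2) by rewrite divr_gt0 ?exprn_gt0// mulr_gt0 ?exprn_gt0.
have := expRN_le_cube u0.
have -> : 6 / (y ^+ 2 / (4 * s ^+ 2)) ^+ 3 = 384 * s ^+ 6 / y ^+ 6.
  by field; rewrite !gt_eqF.
lra.
Qed.

End GaussianTail.

(** * Dyadic chaining *)

Section DyadicChaining.
Context {R : realType}.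
Variables (a delta : R).

Definition dyadic_pt (k i : nat) : R := a + delta * (i%:R / 2 ^+ k).

Lemma dyadic_pt_double k i : dyadic_pt k.+1 i.*2 = dyadic_pt k i.
Proof.
rewrite /dyadic_pt -muln2 natrM exprS; congr (_ + _ * _); field.
by rewrite expf_neq0.
Qed.

Lemma dyadic_pt_ge k i : 0 <= delta -> a <= dyadic_pt k i.
Proof. by move=> d0; rewrite lerDl mulr_ge0// divr_ge0// exprn_ge0. Qed.

Lemma dyadic_ptS k i : dyadic_pt k i.+1 - dyadic_pt k i = delta / 2 ^+ k.
Proof. by rewrite /dyadic_pt -natr1; ring. Qed.

(** A dyadic point of level [k + 1] is of level [k] or directly follows such a point, so the error
    grows by one tolerance per level. *)
Lemma dyadic_chaining (f : R -> R) (e : R) :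
  0 <= e ->
  (forall k i, (i < 2 ^ k)%N ->
    `|f (dyadic_pt k i.+1) - f (dyadic_pt k i)| <= e / 10 * (9/10) ^+ k) ->
  forall k i, (i <= 2 ^ k)%N -> `|f (dyadic_pt k i) - f a| <= e.
Proof.
move=> e0 incr.
(* The bound is the partial sum of the tolerances up to level [k], in closed form. *)
have sharp k i : (i <= 2 ^ k)%N ->
    `|f (dyadic_pt k i) - f a| <= e * (1 - (9/10) ^+ k.+1).
  elim: k i => [|k ih] i ik.
    rewrite expn0 in ik; have a0 : dyadic_pt 0 0 = a by rewrite /dyadic_pt; ring.
    case: i ik => [_|[_|//]].
      by rewrite a0 subrr normr0 mulr_ge0// subr_ge0 exprn_ile1//; lra.
    by have := incr 0%N 0%N isT; rewrite a0 expr0 expr1; lra.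
  have mono : e * (1 - (9/10) ^+ k.+1) <= e * (1 - (9/10) ^+ k.+2).
    rewrite ler_wpM2l// lerD2l lerN2 (exprS _ k.+1) ler_piMl// ?exprn_ge0//; lra.
  have [io|ie] := boolP (odd i); last first.
    have iE : i = (i./2).*2 by rewrite -[LHS]odd_double_half (negbTE ie).
    rewrite [X in dyadic_pt _ X]iE dyadic_pt_double.
    apply: (le_trans _ mono); apply: ih.
    by rewrite -leq_double -(muln2 (2 ^ k)) -expnSr -iE.
  have iE : i = (i./2).*2.+1 by rewrite -[LHS]odd_double_half io.
  have ik' : ((i./2).*2 < 2 ^ k.+1)%N by rewrite -iE.
  have i2k : (i./2 <= 2 ^ k)%N.
    by rewrite -leq_double -(muln2 (2 ^ k)) -expnSr ltnW.
  have := incr k.+1 _ ik'; rewrite -iE dyadic_pt_double => h1.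
  have := ih _ i2k => h2.
  have -> : f (dyadic_pt k.+1 i) - f a =
    (f (dyadic_pt k.+1 i) - f (dyadic_pt k i./2)) + (f (dyadic_pt k i./2) - f a) by ring.
  apply: (le_trans (ler_normD _ _)); apply: (le_trans (lerD h1 h2)).
  rewrite (exprS _ k.+1); lra.
move=> k i ik; apply: (le_trans (sharp k i ik)).
by rewrite ler_piMr// lerBlDr lerDl exprn_ge0//; lra.
Qed.

Lemma dyadic_pt_near (t r : R) : 0 < delta -> a <= t <= a + delta -> 0 < r ->
  exists k i, (i <= 2 ^ k)%N /\ `|t - dyadic_pt k i| < r.
Proof.
move=> d0 /andP[at0 ta] r0.
have [k kr] : exists k : nat, delta / 2 ^+ k < r.
  exists (Num.truncn (delta / r)).+1; rewrite ltr_pdivrMr ?exprn_gt0// mulrC -ltr_pdivrMr//.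
  apply: (lt_trans (truncnS_gt _)).
  by rewrite -natrX ltr_nat ltn_expl.
have p2 : 0 < 2 ^+ k :> R by rewrite exprn_gt0.
pose u := (t - a) / delta * 2 ^+ k.
have u0 : 0 <= u by rewrite mulr_ge0 ?(ltW p2)// divr_ge0 ?(ltW d0)// subr_ge0.
have h1 : (Num.truncn u)%:R <= u by rewrite truncn_le.
exists k, (Num.truncn u); split.
  rewrite -(ler_nat R) natrX; apply: (le_trans h1).
  by rewrite /u ler_piMl ?(ltW p2)// ler_pdivrMr// mul1r lerBlDl.
have tE : t = a + delta * (u / 2 ^+ k) by rewrite /u; field; rewrite !gt_eqF.
rewrite [X in X - _]tE /dyadic_pt opprD addrACA subrr add0r -mulrBr -mulrBl.
rewrite mulrA normrM (ger0_norm (_ : 0 <= (2 ^+ k)^-1)) ?invr_ge0 ?(ltW p2)//.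
apply: (le_lt_trans _ kr); rewrite ler_wpM2r ?invr_ge0 ?(ltW p2)//.
rewrite normrM (ger0_norm (ltW d0)) ler_piMr ?(ltW d0)//.
have h2 := truncnS_gt u; rewrite -natr1 in h2.
by rewrite ger0_norm; lra.
Qed.

End DyadicChaining.

Lemma chaining_constant_gt0 {R : realType} (e : R) :
  0 < e -> 0 < 768 * 10 ^+ 6 / e ^+ 6.
Proof.
move=> e0; apply: divr_gt0; last exact: exprn_gt0.
by apply: mulr_gt0; [rewrite ltr0n|apply: exprn_gt0; rewrite ltr0n].
Qed.

Section BrownianIncrements.
Context {d : measure_display} {W : measurableType d} {R : realType}.
Variables (P : probability W R) (B : R -> {RV P >-> R}).
Hypothesis BB : real_brownian_motion B.

Lemma measurable_abs_increment_gt (s t y : R) :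
  measurable [set w | y < `|B t w - B s w|].
Proof.
have mf : measurable_fun setT (fun w => B t w - B s w) by exact: measurable_funB.
by rewrite -[X in measurable X]setTI; exact: (mf measurableT _ (measurable_abs_gt y)).
Qed.

Lemma brownian_increment_tail (s t y : R) : 0 <= s -> s < t -> 0 < y ->
  (P [set w | (y < `|B t w - B s w|)%R] <= (768 * (t - s) ^+ 3 / y ^+ 6)%:E)%E.
Proof.
move=> s0 st y0; have [_ law _] := BB.
have ts : 0 < t - s by rewrite subr_gt0.
have mD := measurable_abs_gt y.
have := law s t s0 st _ mD; rewrite /pushforward => lawE.
have -> : [set w | y < `|B t w - B s w|] =
  (fun w => B t w - B s w) @^-1` [set x : R | y < `|x|] by [].
rewrite lawE; apply: (le_trans (normal_prob_tail _ y0)); first by rewrite sqrtr_gt0.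
by rewrite lee_fin -[6%N]/(2 * 3)%N (exprM (Num.sqrt _) 2 3) sqr_sqrtr ?(ltW ts).
Qed.

(* The ratio 9/10 makes the tolerances summable (to [e]), and (9/10)^6 >= 1/2
   makes the probabilities of failure at the successive levels decrease
   geometrically. *)
Definition chaining_failure (a delta e : R) : set W :=
  \bigcup_k \bigcup_(i : 'I_(2 ^ k)) [set w |
    e / 10 * (9/10) ^+ k <
    `|B (dyadic_pt a delta k i.+1) w - B (dyadic_pt a delta k i) w|].

Lemma measurable_chaining_failure (a delta e : R) :
  measurable (chaining_failure a delta e).
Proof.
apply: bigcupT_measurable => k; apply: measurable_bigcup_fintype => i.
exact: measurable_abs_increment_gt.
Qed.

(** The cube of the duration gives 8^-k, and the tolerance loses at most 2^k, so each of the 2^k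
    increments of level [k] fails with probability at most C/4^k. The levels then sum to 2 C, which
    tends to 0 with [delta]. *)
Lemma chaining_failure_le (a delta e : R) : 0 <= a -> 0 < delta -> 0 < e ->
  (P (chaining_failure a delta e) <=
   (2 * (768 * 10 ^+ 6 / e ^+ 6 * delta ^+ 3))%:E)%E.
Proof.
move=> a0 d0 e0; set C := 768 * 10 ^+ 6 / e ^+ 6 * delta ^+ 3.
have C0 : 0 <= C.
  apply: mulr_ge0; first exact/ltW/chaining_constant_gt0.
  by apply: exprn_ge0; exact: ltW.
have C20 : 0 <= 2 * C by rewrite mulr_ge0.
pose F k : set W := \bigcup_(i : 'I_(2 ^ k)) [set w |
    e / 10 * (9/10) ^+ k <
    `|B (dyadic_pt a delta k i.+1) w - B (dyadic_pt a delta k i) w|].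
have mF k : measurable (F k).
  by apply: measurable_bigcup_fintype => i; exact: measurable_abs_increment_gt.
apply: (@le_trans _ _ (\sum_(k <oo) P (F k))%E).
  by apply: measure_sigma_subadditive => //; exact: measurable_chaining_failure.
apply: (le_trans _ (epsilon_trick0 xpredT C20)).
apply: lee_nneseries => k _ //=.
have := @probability_bigcup_le _ _ _ P 'I_(2 ^ k) _ (C * (1 / 4 ^+ k)).
move=> /(_ (fun i => [set w | e / 10 * (9/10) ^+ k <
    `|B (dyadic_pt a delta k i.+1) w - B (dyadic_pt a delta k i) w|])).
move=> h; apply: (le_trans (h _ _)).
- by move=> i; exact: measurable_abs_increment_gt.
- move=> i; have p2 : 0 < 2 ^+ k :> R by rewrite exprn_gt0.
  have p9 : 0 < (9/10) ^+ k :> R by rewrite exprn_gt0//; lra.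
  have y0 : 0 < e / 10 * (9/10) ^+ k by rewrite mulr_gt0// divr_gt0.
  apply: (le_trans (brownian_increment_tail _ _ y0)).
  + by apply: (le_trans a0); apply: dyadic_pt_ge; exact: ltW.
  + by rewrite -subr_gt0 dyadic_ptS divr_gt0.
  rewrite dyadic_ptS lee_fin.
  have -> : 768 * (delta / 2 ^+ k) ^+ 3 / (e / 10 * (9/10) ^+ k) ^+ 6 =
      C * (1 / ((2 ^+ k) ^+ 3 * ((9/10) ^+ k) ^+ 6)).
    rewrite /C; move: (2 ^+ k) ((9/10) ^+ k) p2 p9 => u v u0 v0.
    by field; rewrite !gt_eqF.
  rewrite ler_wpM2l// !div1r lef_pV2 ?posrE ?mulr_gt0 ?exprn_gt0//.
  rewrite (exprAC 2 k 3) (exprAC (9/10) k 6) -exprMn.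
  by apply: lerXn2r; rewrite ?nnegrE//; lra.
rewrite card_ord lee_fin natrX (natrX _ 2 k.+1) exprS.
have -> : 4 = 2 * 2 :> R by ring.
rewrite exprMn; have : 0 < 2 ^+ k :> R by rewrite exprn_gt0.
move: (2 ^+ k) => u u0.
by rewrite le_eqVlt; apply/orP; left; apply/eqP; field; rewrite gt_eqF.
Qed.

End BrownianIncrements.

(** * Staying in a cap over a short window *)

Section CircleBrownianMotion.
Context {d : measure_display} {W : measurableType d} {R : realType}.
Variables (P : probability W R).

Section staying.
Variables (V : R -> W -> R * R) (c kappa a delta : R).

(** Only dyadic times are tested, which makes this a countable intersection, hence an event of the
    process. *)
Definition staying_event : set W :=
  \bigcap_k \bigcap_(i : 'I_(2 ^ k).+1)
    V (dyadic_pt a delta k i) @^-1` cap c kappa.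

Lemma staying_event_sigma : 0 <= a -> 0 <= delta ->
  sigma_of_process V staying_event.
Proof.
move=> a0 d0.
apply: (@bigcapT_measurable _ (g_sigma_algebraType
  (\bigcup_(t in `[0, +oo[) sigma_of (V t)))) => k.
apply: (@measurable_bigcap_fintype _ (g_sigma_algebraType
  (\bigcup_(t in `[0, +oo[) sigma_of (V t)))) => i.
apply: sub_sigma_algebra; exists (dyadic_pt a delta k i).
  by rewrite /= in_itv/= andbT (le_trans a0)// dyadic_pt_ge.
exact: (sigma_of_preimage _ (measurable_cap c kappa)).
Qed.

Variable B : R -> {RV P >-> R}.
Hypothesis BB : real_brownian_motion B.
Hypothesis VB : forall t w, 0 <= t -> V t w = circle_pt (B t w).

(** The gap between [kappa'] and [kappa] turns a failure at time [t] into an open condition, which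
    by continuity persists at a nearby dyadic time. *)
Lemma staying_event_cap kappa' w t : 0 <= a -> 0 < delta -> kappa' < kappa ->
  staying_event w -> a <= t <= a + delta -> cap c kappa' (V t w).
Proof.
move=> a0 d0 kk stay ta; have t0 : 0 <= t by case/andP: ta => ? _; exact: le_trans a0 _.
rewrite VB//; apply/cap_circle_pt; rewrite ltNge; apply/negP => low.
have [cont _ _] := BB.
have contB := cont w.
pose g (u : R) := cos (2 * pi * (B u w - c)).
have gt : g x @[x --> within `[0, +oo[ (nbhs t)] --> g t.
  move/subspace_continuousP: contB => /(_ t).
  rewrite /= in_itv/= andbT => /(_ t0) Bt.
  have gc : continuous (fun y : R => cos (2 * pi * (y - c))).
    move=> y; apply: (@continuous_comp R R R (fun y => y - c) (fun x => cos (2 * pi * x))).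
      by apply: cvgB; [exact: cvg_id|exact: cvg_cst].
    exact: continuous_cos2pi.
  exact: (cvg_comp (fun u => B u w) _ Bt (gc (B t w))).
have gk : g t < kappa by exact: le_lt_trans low kk.
have /nbhs_ballP[r /= r0 rP] : within `[0, +oo[ (nbhs t) [set x | g x < kappa].
  exact: (cvgr_lt _ gt _ gk).
have [k [i [ik tr]]] := dyadic_pt_near d0 ta r0.
have pt0 : 0 <= dyadic_pt a delta k i by rewrite (le_trans a0)// dyadic_pt_ge// ltW.
have lowi := rP (dyadic_pt a delta k i) tr; rewrite /= in_itv/= andbT in lowi.
have {}lowi := lowi pt0.
have ik' : (i < (2 ^ k).+1)%N by rewrite ltnS.
have := stay k I (Ordinal ik') I; rewrite /= VB// => /cap_circle_pt.
by rewrite ltNge => /negP; apply; exact: ltW.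
Qed.

End staying.

(** Modulo 1, [D] lies just after one of the [m] points i/m. If every one of these had probability
    at most 1/(2 m), the total would be at most 1/2. As [m] depends on [kappa] only, the bound is
    uniform in the increment. *)
Lemma pigeonhole_increment (kappa : R) : kappa < 1 ->
  exists2 m : nat, (0 < m)%N & forall D : W -> R, measurable_fun setT D ->
    exists2 i : 'I_m, True &
      (((2 * m%:R)^-1)%:E <= P [set w | (kappa < cos (2 * pi * (D w - i%:R / m%:R)))%R])%E.
Proof.
move=> k1; have [s /andP[s0 s1] sP] := cos2pi_gt_near_int k1.
pose m := (Num.truncn s^-1).+1; have m0 : 0 < m%:R :> R by rewrite ltr0n.
have ms : m%:R^-1 < s.
  by rewrite invf_plt ?posrE//; exact: truncnS_gt.
exists m => // D mD.
pose E (i : 'I_m) := [set w | kappa < cos (2 * pi * (D w - i%:R / m%:R))].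
have mE i : measurable (E i).
  have mf : measurable_fun setT (fun w => cos (2 * pi * (D w - i%:R / m%:R))).
    apply: (@measurableT_comp _ _ _ _ _ _ (fun x : R => cos (2 * pi * x))).
      apply: continuous_measurable_fun; exact: continuous_cos2pi.
    exact: measurable_funB.
  have -> : E i = (fun w => cos (2 * pi * (D w - i%:R / m%:R))) @^-1` `]kappa, +oo[%classic.
    by apply/seteqP; split=> w; rewrite /= in_itv/= andbT.
  by rewrite -[X in measurable X]setTI; exact: mf.
have cover : \bigcup_i E i = setT.
  apply/seteqP; split=> // w _.
  pose k := Num.floor (D w); pose x := D w - k%:~R.
  have [fl fu] := (floor_le (D w), floorD1_gt (D w)).
  rewrite intrD in fu.
  have x0 : 0 <= x by rewrite subr_ge0.
  have x1 : x < 1 by rewrite /x /k; lra.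
  have h1 : (Num.truncn (x * m%:R))%:R <= x * m%:R.
    by rewrite truncn_le// mulr_ge0// ltW.
  have h2 := truncnS_gt (x * m%:R); rewrite -natr1 in h2.
  have im : (Num.truncn (x * m%:R) < m)%N.
    rewrite -(ltr_nat R); apply: (le_lt_trans h1).
    by rewrite -[ltRHS]mul1r ltr_pM2r.
  exists (Ordinal im) => //; apply: (sP _ k) => /=.
  apply: (le_lt_trans _ ms).
  have -> : D w - (Num.truncn (x * m%:R))%:R / m%:R - k%:~R =
      (x * m%:R - (Num.truncn (x * m%:R))%:R) / m%:R.
    by rewrite /x; field; rewrite gt_eqF.
  rewrite normrM (ger0_norm (_ : 0 <= m%:R^-1)) ?invr_ge0 ?(ltW m0)//.
  by rewrite ler_piMl ?invr_ge0 ?(ltW m0)// ger0_norm; lra.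
apply: contrapT => none.
have small i : (P (E i) <= ((2 * m%:R)^-1)%:E)%E.
  by rewrite leNgt; apply/negP => h; apply: none; exists i => //; exact: ltW.
have := probability_bigcup_le mE small; rewrite cover probability_setT card_ord lee_fin.
have -> : m%:R * (2 * m%:R)^-1 = 1/2 :> R by field; rewrite gt_eqF.
lra.
Qed.

(** If [B 0] is near [c - i/m] and the independent increment up to [a] is near [i/m], then [B a] is
    within [s / 2] of [c] modulo 1. Off the chaining failure the path then moves by at most [s / 4],
    which keeps it within [s]. *)
Lemma staying_event_probability (c kappa : R) : kappa < 1 ->
  exists2 p : R, 0 < p & exists2 K : nat, (0 < K)%N &
    forall V, circle_brownian_motion P V -> forall k : nat,
      (p%:E <= P (staying_event V c kappa (k%:R / K%:R) K%:R^-1))%E.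
Proof.
move=> k1; have [s /andP[s0 s1] sP] := cos2pi_gt_near_int k1.
have s4 : 0 < s / 4 by rewrite divr_gt0.
have [kap kap1 kapP] := near_int_cos2pi_gt s4.
have [m m0 mP] := pigeonhole_increment kap1.
have [p1 p10 p1P] := uniform_on_circle_cap P kap1.
have mR : 0 < m%:R :> R by rewrite ltr0n.
(* Half of the lower bound p1/(2 m) for the start and the increment; the other half pays for the
   chaining failure. *)
pose p := p1 / (4 * m%:R); have p0 : 0 < p by rewrite divr_gt0// mulr_gt0.
pose C : R := 2 * (768 * 10 ^+ 6 / (s / 4) ^+ 6).
have C0 : 0 < C.
  by apply: mulr_gt0; [rewrite ltr0n|exact: chaining_constant_gt0].
(* Makes C/K at most [p], hence also C/K^3, the bound on the chaining failure over a window of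
   length 1/K. *)
pose K := (Num.truncn (C / p)).+1.
have KR : 0 < K%:R :> R by rewrite ltr0n.
have CK : 2 * (768 * 10 ^+ 6 / (s / 4) ^+ 6 * K%:R^-1 ^+ 3) <= p.
  rewrite mulrA -/C exprVn ler_pdivrMr ?exprn_gt0// mulrC -ler_pdivrMr//.
  apply: (le_trans (ltW (truncnS_gt _))); rewrite -/K -natrX ler_nat.
  by rewrite -[leqLHS]expn1 leq_pexp2l.
exists p => //; exists K => // V [B [BB VB uV]] k.
pose a : R := k%:R / K%:R; have a0 : 0 <= a by rewrite divr_ge0// ltW.
have d0 : 0 < K%:R^-1 :> R by rewrite invr_gt0.
have [_ _ indB] := BB.
(* Along the times 0, a, a, ... the increments of index 0 and 1 are [B 0] and [B a - B 0]; this
   includes the case [a = 0]. *)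
pose sq (j : nat) : R := if j is 0 then 0 else a.
have sq_nd : nondecreasing_seq sq by apply/nondecreasing_seqP => -[|j] /=.
have indI := indB sq erefl sq_nd.
have mD : measurable_fun setT (fun w => B a w - B 0 w) by exact: measurable_funB.
have [i _ iP] := mP _ mD.
pose D : set W := (fun w => B a w - B 0 w) @^-1`
  [set x | kap < cos (2 * pi * (x - i%:R / m%:R))].
pose E : set W := B 0 @^-1` (circle_pt @^-1` cap (c - i%:R / m%:R) kap).
have mcos : measurable [set x : R | kap < cos (2 * pi * (x - i%:R / m%:R))].
  have -> : [set x : R | kap < cos (2 * pi * (x - i%:R / m%:R))] =
      circle_pt @^-1` cap (i%:R / m%:R) kap.
    by apply/seteqP; split=> x /= /cap_circle_pt.
  rewrite -[X in measurable X]setTI; apply: measurable_circle_pt => //.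
  exact: measurable_cap.
have mcirc : measurable (circle_pt @^-1` cap (c - i%:R / m%:R) kap).
  rewrite -[X in measurable X]setTI; apply: measurable_circle_pt => //.
  exact: measurable_cap.
have PE : (p1%:E <= P E)%E.
  have -> : E = V 0 @^-1` cap (c - i%:R / m%:R) kap.
    by apply/seteqP; split=> w /=; rewrite VB.
  exact: p1P.
have mE : measurable E by rewrite -[X in measurable X]setTI; exact: measurable_funP.
have mD' : measurable D by rewrite -[X in measurable X]setTI; exact: mD.
have PED : ((2 * p)%:E <= P (E `&` D))%E.
  pose A (b : bool) : set W := if b then D else E.
  have -> : E `&` D = \bigcap_b A b.
    apply/seteqP; split=> w; first by move=> [wE wD] [].
    by move=> wA; split; [exact: (wA false)|exact: (wA true)].
  have FA b : sigma_of (increment B sq (nat_of_bool b)) (A b).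
    by case: b; [exact: (sigma_of_preimage _ mcos)|exact: (sigma_of_preimage _ mcirc)].
  have inj_b : injective nat_of_bool by move=> [] [].
  rewrite (independent_bigcap indI inj_b FA) big_bool /=.
  have -> : (2 * p)%:E = (((2 * m%:R)^-1)%:E * p1%:E)%E.
    by rewrite -EFinM /p; congr EFin; field; rewrite gt_eqF.
  by apply: lee_pmul => //; rewrite lee_fin ?invr_ge0 ?mulr_ge0 ?(ltW mR) ?(ltW p10).
pose F := chaining_failure B a K%:R^-1 (s / 4).
have mF : measurable F by exact: measurable_chaining_failure.
have PF : (P F <= p%:E)%E.
  by apply: (le_trans (chaining_failure_le BB a0 d0 s4)); rewrite lee_fin.
have sub : (E `&` D) `\` F `<=` staying_event V c kappa a K%:R^-1.
  move=> w [[wE wD] wF] l _ j _ /=.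
  have pt0 : 0 <= dyadic_pt a K%:R^-1 l j by rewrite (le_trans a0)// dyadic_pt_ge// ltW.
  rewrite VB//; apply/cap_circle_pt.
  have [k2 k2P] := kapP _ wD.
  move: wE => /cap_circle_pt /kapP[k3 k3P].
  have chain : `|B (dyadic_pt a K%:R^-1 l j) w - B a w| <= s / 4.
    apply: (dyadic_chaining (f := fun t => B t w) (ltW s4)); last by rewrite -ltnS.
    move=> l' j' jl'; rewrite leNgt; apply/negP => h; apply: wF.
    by exists l' => //; exists (Ordinal jl').
  apply: (sP _ (k2 + k3)).
  rewrite intrD.
  set b := B (dyadic_pt _ _ _ _) w in chain *.
  have -> : b - c - (k2%:~R + k3%:~R) =
    (b - B a w) + ((B a w - B 0 w - i%:R / m%:R - k2%:~R) +
                   (B 0 w - (c - i%:R / m%:R) - k3%:~R)) by ring.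
  apply: (le_lt_trans (ler_normD _ _)).
  have := ler_normD (B a w - B 0 w - i%:R / m%:R - k2%:~R)
                    (B 0 w - (c - i%:R / m%:R) - k3%:~R).
  lra.
have mstay : measurable (staying_event V c kappa a K%:R^-1).
  apply: bigcapT_measurable => l; apply: measurable_bigcap_fintype => j.
  have pt0 : 0 <= dyadic_pt a K%:R^-1 l j by rewrite (le_trans a0)// dyadic_pt_ge// ltW.
  have -> : V (dyadic_pt a K%:R^-1 l j) @^-1` cap c kappa =
    B (dyadic_pt a K%:R^-1 l j) @^-1` (circle_pt @^-1` cap c kappa).
    by apply/seteqP; split=> w /=; rewrite VB.
  rewrite -[X in measurable X]setTI; apply: measurable_funP => //.
  rewrite -[X in measurable X]setTI; apply: measurable_circle_pt => //.
  exact: measurable_cap.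
have mED : measurable (E `&` D) by exact: measurableI.
have : (P (E `&` D) <= P (staying_event V c kappa a K%:R^-1 `|` F))%E.
  apply: le_measure; rewrite ?inE//; first exact: measurableU.
  by move=> w wED; have [wF|wF] := pselect (F w); [right|left; exact: sub].
(* Subtracting the chaining failure, at most [p], from [2 * p] leaves [p]. *)
move=> /(le_trans PED) /le_trans /(_ (measureU2 _ mstay mF)) h.
have := le_trans h (leeD2l _ PF).
have -> : 2 * p = p + p by ring.
by rewrite EFinD leeD2rE.
Qed.

End CircleBrownianMotion.

Section BrownianDense.
Context {d : measure_display} {W : measurableType d} {R : realType}.
Variables (P : probability W R).

Lemma circle_brownian_motion_process_measurable (V : R -> W -> R * R) :
  circle_brownian_motion P V -> sigma_of_process V `<=` measurable.
Proof.
move=> [B [_ VB _]]; apply: smallest_sub; first exact: sigma_algebra_measurable.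
move=> _ [t t0 [A mA <-]]; rewrite setTI.
have {}t0 : 0 <= t by move: t0; rewrite /= in_itv/= andbT.
have -> : V t @^-1` A = B t @^-1` (circle_pt @^-1` A).
  by apply/seteqP; split=> w /=; rewrite VB.
rewrite -[X in measurable X]setTI; apply: measurable_funP => //.
by rewrite -[X in measurable X]setTI; exact: measurable_circle_pt.
Qed.

Lemma negligible_brownian_avoids_cap (U : nat -> R -> W -> R * R) (N : nat)
    (c kappa : R) : brownian_model P U -> kappa < 1 ->
  P.-negligible [set w | exists2 t, t \in `[0, 1] &
    forall n, (N <= n)%N -> ~ cap c kappa (U n t w)].
Proof.
(* A cap strictly inside the given one leaves room for passing from dyadic times to all times. *)
move=> [BU indU] k1; pose kappa' := (kappa + 1) / 2.
have kk : kappa < kappa' by rewrite /kappa'; lra.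
have k'1 : kappa' < 1 by rewrite /kappa'; lra.
have [p p0 [K K0 stayP]] := staying_event_probability P c k'1.
have KR : 0 < K%:R :> R by rewrite ltr0n.
have d0 : 0 < K%:R^-1 :> R by rewrite invr_gt0.
pose A (k n : nat) := staying_event (U n) c kappa' (k%:R / K%:R) K%:R^-1.
have a0 k : 0 <= k%:R / K%:R :> R by rewrite divr_ge0// ltW.
have sA k n : sigma_of_process (U n) (A k n).
  by apply: staying_event_sigma; [exact: a0|exact: ltW].
have mA k n : measurable (A k n).
  by apply: (circle_brownian_motion_process_measurable (BU n)); exact: sA.
have p1 : p <= 1.
  rewrite -lee_fin; apply: (le_trans (stayP _ (BU 0%N) 0%N)).
  by apply: probability_le1; exact: mA.
have sAC k n : sigma_of_process (U n) (~` A k n).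
  exact: (@measurableC _ (g_sigma_algebraType
    (\bigcup_(t in `[0, +oo[) sigma_of (U n t))) _ (sA k n)).
apply: negligible_small => e e0.
have p10 : 0 <= 1 - p < 1 by apply/andP; split; lra.
(* There are [K.+1] windows of length 1/K, the last one catching [t = 1]. *)
have eK : 0 < e / K.+1%:R by rewrite divr_gt0.
have [m mP] := polynomial_geometric_small 0 p10 eK.
have {}mP := mP m (leqnn m); rewrite expr0 mul1r in mP.
pose F (k : 'I_K.+1) : set W := \bigcap_(n : 'I_m) ~` A k (N + n)%N.
have mF k : measurable (F k) by apply: measurable_bigcap_fintype => n; exact: measurableC.
exists (\bigcup_k F k); split.
- exact: measurable_bigcup_fintype.
- move=> w [t t01 miss].
  have /andP[t0 t1] : 0 <= t <= 1 by move: t01; rewrite in_itv.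
  have tK0 : 0 <= t * K%:R by rewrite mulr_ge0// ltW.
  pose k := Num.truncn (t * K%:R).
  have h1 : k%:R <= t * K%:R by rewrite /k truncn_le.
  have h2 : t * K%:R < k%:R + 1 by rewrite natr1; exact: truncnS_gt.
  have kK : (k < K.+1)%N.
    by rewrite ltnS -(ler_nat R) (le_trans h1)// ler_piMl// ltW.
  exists (Ordinal kK) => // n _ An; apply: (miss (N + n)%N); first exact: leq_addr.
  have [B [BB VB _]] := BU (N + n)%N.
  apply: (staying_event_cap BB VB (a0 k) d0 kk An).
  rewrite ler_pdivrMr// h1 -[X in _ + X]mul1r -mulrDl ler_pdivlMr//=.
  exact: ltW.
- apply: (@le_trans _ _ (#|'I_K.+1|%:R * ((1 - p) ^+ m))%:E).
    apply: probability_bigcup_le => // k; rewrite -[in leRHS](card_ord m).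
    apply: (independent_bigcap_le indU (f := fun n : 'I_m => (N + n)%N)) => //.
      by move=> n n' /addnI /ord_inj.
    move=> n; apply: probability_setC_le => //.
    exact: (stayP _ (BU (N + n)%N) k).
  by rewrite card_ord lee_fin mulrC -ler_pdivlMr.
Qed.

Lemma negligible_exceptional_brownian (ell : nat -> R)
    (U : nat -> R -> W -> R * R) : (forall n, 0 < ell n) ->
  brownian_model P U ->
  P.-negligible [set w | exceptional_times ell U w !=set0].
Proof.
move=> ell0 BU; apply: negligible_exceptional_times => //.
  move=> n t w t0; have [B [_ VB _]] := BU.1 n.
  by rewrite VB//; exists (B t w).
by move=> N c kappa; exact: negligible_brownian_avoids_cap.
Qed.

End BrownianDense.

Theorem theorem1p8 (R : realType) :
  (forall ell : nat -> R, lengths ell ->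
    forall (d : measure_display) (W : measurableType d) (P : probability W R)
      (U : nat -> R -> W -> R * R),
    brownian_model P U ->
    P.-negligible [set w | exceptional_times ell U w !=set0])
  /\
  ((forall (alpha : R) (ell : nat -> R), 0 < alpha -> lengths ell ->
      (exists c : R, forall n : nat, ell n >= 1 / n.+1%:R `^ c) ->
      forall (d : measure_display) (W : measurableType d) (P : probability W R)
        (U : nat -> R -> W -> R * R),
      poisson_model P ell alpha U ->
      P.-negligible [set w | exceptional_times ell U w !=set0])
   /\
   (forall ell : nat -> R, lengths ell ->
      forall (d : measure_display) (W : measurableType d) (P : probability W R)
        (U : nat -> R -> W -> R * R),
      poisson_model P ell 0 U ->
      P.-negligible [set w | exceptional_times ell U w !=set0]))
  /\
  (forall alpha : R, 0 < alpha ->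
    exists ell : nat -> R, [/\ lengths ell, decreasing_seq ell &
      forall (d : measure_display) (W : measurableType d) (P : probability W R)
        (U : nat -> R -> W -> R * R),
      poisson_model P ell alpha U ->
      {ae P, forall w, exceptional_times ell U w !=set0}]).
Proof.
split; [|split; [split|]].
- move=> ell [ell0 _ _] d W P U; exact: negligible_exceptional_brownian.
- move=> alpha ell alpha0 [ell0 _ _] [c ellc] d W P U.
  have [k ratek] := poisson_rate_le alpha0 ell0 ellc.
  exact: (negligible_exceptional_poisson ell0 ratek).
- move=> ell [ell0 _ _] d W P U.
  (* For [alpha = 0] all rates equal 1, so degree 0 suffices. *)
  apply: (@negligible_exceptional_poisson _ _ _ P ell 0 U 0) => // n.
  by rewrite oppr0 powRr0 expr0.
- exact: sparse_poisson_exceptional.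
Qed.
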